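(* For every discrete group $G$, $\mathrm{Tame}(l_1(G))=\mathrm{Tame}(G)$. That is, under the canonical identification $l_1(G)^*\cong l_\infty(G)$, $f\mapsto f\circ\delta$, a continuous linear functional $f\in l_1(G)^*$ is a tame functional on the Banach algebra $l_1(G)$ if and only if the corresponding bounded function $f\circ\delta: G\to\mathbb{R}$ is a tame function on $G$.
   Context: All Banach spaces and algebras are real. **Group algebra.** For a discrete group $G$, $l_1(G)$ is the Banach algebra of absolutely summable functions $G\to\mathbb{R}$ with the $l_1$-norm and the convolution product $\star$. For $s\in G$, $\delta_s\in l_1(G)$ is the function with $\delta_s(s)=1$ and $\delta_s(x)=0$ for $x\neq s$; thus $\delta_s\star\delta_t=\delta_{st}$. Write $\delta: G\to l_1(G)$, $s\mapsto\delta_s$. $l_\infty(G)$ is the Banach space of bounded functions $G\to\mathbb{R}$ with the sup-norm. The map $f\mapsto f\circ\delta$ is the canonical isomorphism of Banach spaces $l_1(G)^*\to l_\infty(G)$. **Rosenthal spaces and operators.** A Banach space is Rosenthal if it does not contain an isomorphic copy of $l_1$. A continuous linear operator $T:V_1\to V_2$ between Banach spaces is a Rosenthal operator if there exist a Rosenthal Banach space $V_3$ and continuous linear operators $\alpha:V_1\to V_3$, $\beta:V_3\to V_2$ such that $T=\beta\circ\alpha$. **Tame functionals.** Let $\mathcal{A}$ be a Banach algebra with multiplication $\star$ and let $\lambda\in\mathcal{A}^*$. For $a\in\mathcal{A}$ define $\lambda\cdot a\in\mathcal{A}^*$ by $(\lambda\cdot a)(x)=\lambda(a\star x)$. The functional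 $\lambda$ is tame, written $\lambda\in\mathrm{Tame}(\mathcal{A})$, if the continuous linear operator $\mathcal{A}\to\mathcal{A}^*$, $a\mapsto\lambda\cdot a$, is a Rosenthal operator. **Tame functions on a discrete group.** A sequence $\{f_n:X\to\mathbb{R}\}_{n\in\mathbb{N}}$ of functions on a set $X$ is independent if there exist real numbers $a<b$ such that $\bigcap_{n\in P}f_n^{-1}(-\infty,a)\cap\bigcap_{n\in M}f_n^{-1}(b,\infty)\neq\emptyset$ for all finite disjoint subsets $P,M$ of $\mathbb{N}$. A bounded family $F$ of real-valued functions on $X$ is tame if it does not contain an independent sequence. For $f:G\to\mathbb{R}$ and $s\in G$ put $(fs)(t)=f(st)$ and $fG=\{fs:s\in G\}$. For a discrete group $G$ (where every bounded function is right uniformly continuous), a bounded function $f:G\to\mathbb{R}$ is tame, written $f\in\mathrm{Tame}(G)$, if $fG$ is a tame family of functions on $G$. *)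

(* Defs.v *)
From HB Require Import structures.
From mathcomp Require Import all_boot all_order all_algebra finmap.
From mathcomp Require Import mathcomp_extra boolp classical_sets functions cardinality.
From mathcomp Require Import fsbigop interval_inference reals ereal topology.
From mathcomp Require Import normedtype numfun esum.
From mathcomp Require Import monoid lra ring.

Set Implicit Arguments.
Unset Strict Implicit.
Unset Printing Implicit Defensive.

Import Order.TTheory GRing.Theory Num.Theory.
Import numFieldNormedType.Exports.

Local Open Scope classical_set_scope.
Local Open Scope ring_scope.

Section unordered_sum.
Context {R : realType}.

Definition abs_summable (I : choiceType) (f : I -> R) : bool :=
  summable [set: I] (EFin \o f).

Definition norm1 (I : choiceType) (f : I -> R) : R :=
  fine (\esum_(i in [set: I]) `|(f i)%:E|)%E.

(* Absolutely convergent sum of a real family: the library's [esum] is only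
   meaningful for nonnegative terms. *)
Definition usum (I : choiceType) (f : I -> R) : R :=
  fine (\esum_(i in [set: I]) (EFin \o f)^\+ i)%E
  - fine (\esum_(i in [set: I]) (EFin \o f)^\- i)%E.

Section theory.
Context {I : choiceType}.
Implicit Types f g p n : I -> R.

Lemma norm1E f : abs_summable f ->
  (norm1 f)%:E = (\esum_(i in [set: I]) `|(f i)%:E|)%E.
Proof. by rewrite /abs_summable summableE => /fineK. Qed.

Lemma norm1_ge0 f : 0 <= norm1 f.
Proof. by apply: fine_ge0; apply: esum_ge0. Qed.

Lemma abs_summable_le f g : (forall i, `|f i| <= `|g i|) ->
  abs_summable g -> abs_summable f.
Proof.
move=> fg; apply: le_lt_trans; apply: le_esum => i _ /=.
by rewrite lee_fin.
Qed.

Lemma norm1_le f g : (forall i, `|f i| <= `|g i|) ->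
  abs_summable g -> norm1 f <= norm1 g.
Proof.
move=> fg sg; have sf := abs_summable_le fg sg.
rewrite -lee_fin !norm1E//; apply: le_esum => i _ /=.
by rewrite lee_fin.
Qed.

Lemma abs_summableD f g : abs_summable f -> abs_summable g ->
  abs_summable (fun i => f i + g i).
Proof. exact: summableD. Qed.

Lemma norm1D_ge0 f g : abs_summable f -> abs_summable g ->
  (forall i, 0 <= f i) -> (forall i, 0 <= g i) ->
  norm1 (fun i => f i + g i) = norm1 f + norm1 g.
Proof.
move=> sf sg f0 g0; apply: EFin_inj.
rewrite EFinD !norm1E//; last exact: abs_summableD.
rewrite -esumD//; apply: eq_esum => i _ /=.
by rewrite !ger0_norm// addr_ge0.
Qed.

Lemma norm1D f g : abs_summable f -> abs_summable g ->
  norm1 (fun i => f i + g i) <= norm1 f + norm1 g.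
Proof.
move=> sf sg; rewrite -lee_fin EFinD !norm1E//; last exact: abs_summableD.
rewrite -esumD//; apply: le_esum => i _ /=.
by rewrite lee_fin ler_normD.
Qed.

Lemma norm1_abs f : norm1 (fun i => `|f i|) = norm1 f.
Proof. by congr fine; apply: eq_esum => i _ /=; rewrite normr_id. Qed.

Lemma abs_summable_abs f : abs_summable (fun i => `|f i|) = abs_summable f.
Proof.
rewrite /abs_summable /summable; congr (_ < _)%E.
by apply: eq_esum => i _ /=; rewrite normr_id.
Qed.

Lemma ge_norm1 f (M : R) :
  (forall A : {fset I}, \sum_(i <- A) `|f i| <= M) ->
  abs_summable f /\ norm1 f <= M.
Proof.
move=> H; have E : (\esum_(i in [set: I]) `|(f i)%:E| <= M%:E)%E.
  apply: ge_ereal_sup => _ [A [finA _] <-].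
  rewrite fsbig_finite//= (eq_bigr (fun i => (`|f i|)%:E))//.
  by rewrite sumEFin lee_fin.
have sf : abs_summable f by apply: le_lt_trans E _; rewrite ltry.
by split=> //; rewrite -lee_fin norm1E.
Qed.

Lemma norm1_ge f (A : {fset I}) : abs_summable f ->
  \sum_(i <- A) `|f i| <= norm1 f.
Proof.
move=> sf; rewrite -lee_fin norm1E//; apply: esum_ge.
exists [set` A] => //.
by rewrite fsbig_finite//= set_fsetK (eq_bigr (fun i => (`|f i|)%:E))// sumEFin.
Qed.

Lemma norm1_ge1 f i : abs_summable f -> `|f i| <= norm1 f.
Proof.
by move=> sf; have := norm1_ge [fset i]%fset sf; rewrite big_seq_fset1.
Qed.

Lemma norm1_eq0 f : abs_summable f -> norm1 f = 0 -> f = fun=> 0.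
Proof.
move=> sf f0; apply/funext => i; apply/eqP; rewrite -normr_eq0 -[_ == _]orbF.
by rewrite eq_le normr_ge0 andbT orbF -f0 norm1_ge1.
Qed.

Lemma norm1Z_le (c : R) f : abs_summable f ->
  abs_summable (fun i => c * f i) /\ norm1 (fun i => c * f i) <= `|c| * norm1 f.
Proof.
move=> sf; apply: ge_norm1 => A.
under eq_bigr do rewrite normrM.
by rewrite -mulr_sumr ler_wpM2l// norm1_ge.
Qed.

Lemma abs_summableZ (c : R) f : abs_summable f ->
  abs_summable (fun i => c * f i).
Proof. by case/(norm1Z_le c). Qed.

Lemma norm1Z (c : R) f : abs_summable f ->
  norm1 (fun i => c * f i) = `|c| * norm1 f.
Proof.
move=> sf; have [scf le1] := norm1Z_le c sf.
apply/eqP; rewrite eq_le le1/=; have [->|c0] := eqVneq c 0.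
  by rewrite normr0 mul0r; exact: norm1_ge0.
have := (norm1Z_le c^-1 scf).2.
rewrite (_ : (fun i => _) = f); last by apply/funext => i; rewrite mulKf.
by rewrite normfV ler_pdivlMl// normr_gt0.
Qed.

Lemma abs_summable0 : abs_summable (fun _ : I => 0 : R).
Proof.
by apply: (@ge_norm1 _ 0 _).1 => A; rewrite big1// => i _; rewrite normr0.
Qed.

Lemma abs_summableN f : abs_summable f -> abs_summable (fun i => - f i).
Proof. by apply: abs_summable_le => i; rewrite normrN. Qed.

Lemma usum_sub p n : abs_summable p -> abs_summable n ->
  (forall i, 0 <= p i) -> (forall i, 0 <= n i) ->
  usum (fun i => p i - n i) = norm1 p - norm1 n.
Proof.
move=> sp sn p0 n0.
have := @esumB R I [set: I] (EFin \o p) (EFin \o n) sp sn.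
have -> : (\esum_(i in [set: I]) (EFin \o p) i)%E = (norm1 p)%:E.
  rewrite norm1E//; apply: eq_esum => i _ /=; by rewrite ger0_norm.
have -> : (\esum_(i in [set: I]) (EFin \o n) i)%E = (norm1 n)%:E.
  rewrite norm1E//; apply: eq_esum => i _ /=; by rewrite ger0_norm.
move=> /(_ (fun i _ => p0 i) (fun i _ => n0 i)) H.
rewrite /usum -fineB; last 2 first.
- have spn : summable [set: I] (EFin \o (fun i => p i - n i)).
    exact: (abs_summableD sp (abs_summableN sn)).
  have := summable_funepos spn; rewrite summableE.
  by under eq_esum do rewrite gee0_abs//.
- have spn : summable [set: I] (EFin \o (fun i => p i - n i)).
    exact: (abs_summableD sp (abs_summableN sn)).
  have := summable_funeneg spn; rewrite summableE.
  by under eq_esum do rewrite gee0_abs//.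
by rewrite -[RHS]/(fine (norm1 p - norm1 n)%:E) EFinB -H.
Qed.

Definition pos f i := Num.max (f i) 0.
Definition neg f i := Num.max (- f i) 0.

Lemma pos_ge0 f i : 0 <= pos f i. Proof. by rewrite le_max lexx orbT. Qed.
Lemma neg_ge0 f i : 0 <= neg f i. Proof. by rewrite le_max lexx orbT. Qed.

Lemma pos_neg f i : f i = pos f i - neg f i.
Proof.
rewrite /pos /neg; have [h|h] := orP (le_total 0 (f i)).
  by rewrite max_l// max_r ?oppr_le0// subr0.
by rewrite max_r ?h// max_l ?oppr_ge0 ?h// sub0r opprK.
Qed.

Lemma abs_pos_neg f i : `|f i| = pos f i + neg f i.
Proof.
rewrite /pos /neg; have [h|h] := orP (le_total 0 (f i)).
  by rewrite max_l// max_r ?oppr_le0// addr0 ger0_norm.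
by rewrite max_r ?h// max_l ?oppr_ge0 ?h// add0r ler0_norm.
Qed.

Lemma pos_le f i : `|pos f i| <= `|f i|.
Proof. by rewrite ger0_norm ?pos_ge0// abs_pos_neg lerDl neg_ge0. Qed.

Lemma neg_le f i : `|neg f i| <= `|f i|.
Proof. by rewrite ger0_norm ?neg_ge0// abs_pos_neg lerDr pos_ge0. Qed.

Lemma abs_summable_pos f : abs_summable f -> abs_summable (pos f).
Proof. by apply: abs_summable_le => i; exact: pos_le. Qed.

Lemma abs_summable_neg f : abs_summable f -> abs_summable (neg f).
Proof. by apply: abs_summable_le => i; exact: neg_le. Qed.

Lemma usumE f : abs_summable f -> usum f = norm1 (pos f) - norm1 (neg f).
Proof.
move=> sf; have [sp sn] := (abs_summable_pos sf, abs_summable_neg sf).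
rewrite -usum_sub//.
- by congr usum; apply/funext => i; rewrite -pos_neg.
- exact: pos_ge0.
- exact: neg_ge0.
Qed.

Lemma usumD f g : abs_summable f -> abs_summable g ->
  usum (fun i => f i + g i) = usum f + usum g.
Proof.
move=> sf sg; rewrite (usumE sf) (usumE sg).
have [spf snf] := (abs_summable_pos sf, abs_summable_neg sf).
have [spg sng] := (abs_summable_pos sg, abs_summable_neg sg).
rewrite addrACA -opprD -!norm1D_ge0// => [|i|i|i|i];
  rewrite ?pos_ge0 ?neg_ge0//.
rewrite -usum_sub ?abs_summableD// => [|i|i];
  rewrite ?addr_ge0 ?pos_ge0 ?neg_ge0//.
by congr usum; apply/funext => i; rewrite [f i]pos_neg [g i]pos_neg; ring.
Qed.

Lemma usumN f : abs_summable f -> usum (fun i => - f i) = - usum f.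
Proof.
move=> sf; have [sp sn] := (abs_summable_pos sf, abs_summable_neg sf).
rewrite (usumE sf) opprB -usum_sub// => [|i|i]; rewrite ?pos_ge0 ?neg_ge0//.
by congr usum; apply/funext => i; rewrite [f i]pos_neg opprB.
Qed.

Lemma usumZ (c : R) f : abs_summable f ->
  usum (fun i => c * f i) = c * usum f.
Proof.
wlog c0 : c / 0 <= c => [H|] sf.
  have [|/ltW] := leP 0 c; first by move/H; exact.
  rewrite -oppr_ge0 => /H /(_ sf) {}H.
  apply: oppr_inj; rewrite -mulNr -H -usumN; last exact: abs_summableZ.
  by congr usum; apply/funext => i; rewrite mulNr.
have [spf snf] := (abs_summable_pos sf, abs_summable_neg sf).
rewrite (usumE sf) mulrBr -{2 3}(ger0_norm c0) -!norm1Z//.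
rewrite -usum_sub ?abs_summableZ// => [|i|i];
  rewrite ?mulr_ge0 ?pos_ge0 ?neg_ge0//.
by congr usum; apply/funext => i; rewrite -mulrBr -pos_neg.
Qed.

Lemma norm1_split f : abs_summable f ->
  norm1 f = norm1 (pos f) + norm1 (neg f).
Proof.
move=> sf; have [sp sn] := (abs_summable_pos sf, abs_summable_neg sf).
rewrite -norm1D_ge0//.
- by rewrite -norm1_abs; congr norm1; apply/funext => i; rewrite abs_pos_neg.
- exact: pos_ge0.
- exact: neg_ge0.
Qed.

Lemma ler_usum f : abs_summable f -> `|usum f| <= norm1 f.
Proof.
move=> sf; rewrite norm1_split// usumE//.
by apply: le_trans (ler_normB _ _) _; rewrite !ger0_norm ?norm1_ge0.
Qed.

Lemma usum_ge0 f : abs_summable f -> (forall i, 0 <= f i) -> usum f = norm1 f.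
Proof.
move=> sf f0; have := usum_sub sf abs_summable0 f0 (fun=> lexx 0).
have -> : norm1 (fun _ : I => 0 : R) = 0.
  by rewrite /norm1 esum1// => i _; rewrite abse0.
by rewrite subr0 => <-; congr usum; apply/funext => i; rewrite subr0.
Qed.

Lemma usum_fin f (A : {fset I}) : (forall i, i \notin A -> f i = 0) ->
  abs_summable f /\ usum f = \sum_(i <- A) f i.
Proof.
have nE g : (forall i, i \notin A -> g i = 0) -> abs_summable g /\ norm1 g = \sum_(i <- A) `|g i|.
  move=> gA; have [sg le1] : abs_summable g /\ norm1 g <= \sum_(i <- A) `|g i|.
    apply: ge_norm1 => B.
    rewrite (big_fsetID _ (mem A))/= [X in _ + X]big1_fset ?addr0; last first.
      by move=> i; rewrite !inE/= => /andP[_ /gA ->]; rewrite normr0.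
    set S := [fset x | x in B & _]%fset.
    rewrite [leRHS](big_fsetID _ (mem S))/=.
    rewrite (_ : [fset x | x in A & x \in S]%fset = S).
      by rewrite lerDl sumr_ge0.
    by apply/fsetP => i; rewrite !inE/=; case: (i \in A); rewrite ?andbF ?andbT.
  by split=> //; apply/eqP; rewrite eq_le le1 norm1_ge.
move=> fA; have [sf _] := nE f fA; split=> //.
have pA i : i \notin A -> pos f i = 0 by move=> /fA; rewrite /pos => ->; rewrite maxxx.
have nA i : i \notin A -> neg f i = 0 by move=> /fA; rewrite /neg => ->; rewrite oppr0 maxxx.
rewrite usumE// (nE _ pA).2 (nE _ nA).2 -sumrB; apply: eq_bigr => i _.
by rewrite !ger0_norm ?pos_ge0 ?neg_ge0// -pos_neg.
Qed.

Lemma norm1_tail f (e : R) : abs_summable f -> 0 < e ->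
  exists A : {fset I}, norm1 (fun i => if i \in A then 0 else f i) <= e.
Proof.
move=> sf e0.
have : ~ (forall A : {fset I}, \sum_(i <- A) `|f i| <= norm1 f - e).
  move=> /(@ge_norm1 f) [_]; rewrite lerBrDl gerDr.
  by rewrite leNgt e0.
move=> /existsNP[A /negP]; rewrite -ltNge => Ae; exists A.
apply: (@ge_norm1 _ e _).2 => B.
rewrite (big_fsetID _ (mem A))/= [X in X + _]big1_fset ?add0r; last first.
  by move=> i; rewrite !inE/= => /andP[_ ->]; rewrite normr0.
have := norm1_ge (A `|` B)%fset sf.
rewrite (big_fsetID _ (mem A))/=.
rewrite (_ : [fset x | x in A `|` B & x \in A]%fset = A); last first.
  by apply/fsetP => i; rewrite !inE/=; case: (i \in A); rewrite ?andbF.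
rewrite (_ : [fset x | x in A `|` B & x \notin A]%fset =
             [fset x | x in B & x \notin A]%fset); last first.
  by apply/fsetP => i; rewrite !inE/=; case: (i \in A); rewrite ?andbF.
rewrite [X in _ -> X <= _](eq_big_seq (fun i => `|f i|)); first by lra.
by move=> i; rewrite !inE/= => /andP[_ /negbTE ->].
Qed.

End theory.

Section reindex.
Context {I J : choiceType} (e : I -> J) (be : bijective e).

Let eb : set_bij [set: I] [set: J] e.
Proof. by rewrite setTT_bijective. Qed.

Lemma norm1_reindex (f : J -> R) : norm1 (f \o e) = norm1 f.
Proof.
by congr fine; rewrite (reindex_esum _ _ _ _ eb).
Qed.

Lemma abs_summable_reindex (f : J -> R) : abs_summable (f \o e) = abs_summable f.
Proof.
by rewrite /abs_summable /summable (reindex_esum _ _ _ _ eb).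
Qed.

Lemma usum_reindex (f : J -> R) : usum (f \o e) = usum f.
Proof.
rewrite /usum !(reindex_esum _ _ _ _ eb).
by congr (fine _ - fine _); apply: eq_esum => i _; rewrite ?funeposE ?funenegE.
Qed.

End reindex.

Section fubini.
Context {I J : choiceType}.
Implicit Type F : I -> J -> R.

Definition uncur F : I * J -> R := fun p => F p.1 p.2.

Let setXT : [set: I * J] = [set: I] `*`` (fun=> [set: J]).
Proof. by apply/seteqP; split. Qed.

Let esum_pairE F : (\esum_(p in [set: I * J]) `|(uncur F p)%:E| =
  \esum_(i in [set: I]) \esum_(j in [set: J]) `|(F i j)%:E|)%E.
Proof. by rewrite setXT esum_esum. Qed.

Lemma pair_summable F : (forall i, abs_summable (F i)) ->
  abs_summable (fun i => norm1 (F i)) -> abs_summable (uncur F).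
Proof.
move=> sF; apply: le_lt_trans.
rewrite esum_pairE; apply: le_esum => i _.
by rewrite /= ger0_norm ?norm1_ge0// norm1E.
Qed.

Lemma summable_pair F : abs_summable (uncur F) ->
  [/\ forall i, abs_summable (F i), abs_summable (fun i => norm1 (F i)) &
      norm1 (uncur F) = norm1 (fun i => norm1 (F i))].
Proof.
move=> s; have s' := s; move: s'.
rewrite /abs_summable /summable esum_pairE => s'.
have sF i : abs_summable (F i).
  have := @summable_pinfty I R [set: I]
    (fun i => \esum_(j in [set: J]) `|(F i j)%:E|)%E.
  rewrite /summable; under eq_esum do rewrite gee0_abs ?esum_ge0//.
  by move=> /(_ s' i Logic.I); rewrite gee0_abs ?esum_ge0.
have E : (\esum_(i in [set: I]) \esum_(j in [set: J]) `|(F i j)%:E| =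
   \esum_(i in [set: I]) `|(norm1 (F i))%:E|)%E.
  by apply: eq_esum => i _; rewrite /= ger0_norm ?norm1_ge0// norm1E.
split=> //; first by rewrite /abs_summable /summable -E.
by rewrite /norm1 esum_pairE E.
Qed.

Lemma usum_pair F : abs_summable (uncur F) ->
  abs_summable (fun i => usum (F i)) /\
  usum (uncur F) = usum (fun i => usum (F i)).
Proof.
move=> s; have [sF snF _] := summable_pair s.
split.
  apply: abs_summable_le snF => i.
  by rewrite [leRHS]ger0_norm ?norm1_ge0// ler_usum.
have sp : abs_summable (uncur (fun i => pos (F i))) := abs_summable_pos s.
have sn : abs_summable (uncur (fun i => neg (F i))) := abs_summable_neg s.
have [spF spnF pE] := summable_pair sp.
have [snF' snnF nE] := summable_pair sn.
rewrite usumE// -[pos _]/(uncur (fun i => pos (F i))).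
rewrite -[neg _]/(uncur (fun i => neg (F i))) pE nE -usum_sub// => [|i|i];
  rewrite ?norm1_ge0//.
by congr usum; apply/funext => i; rewrite usumE.
Qed.

End fubini.

Lemma uncur_swap (I J : choiceType) (F : I -> J -> R) :
  uncur (fun j i => F i j) = uncur F \o (fun p => (p.2, p.1)).
Proof. by []. Qed.

Let swap_bij (I J : Type) : bijective (fun p : J * I => (p.2, p.1)).
Proof. by exists (fun p => (p.2, p.1)); case. Qed.

Lemma summable_swap (I J : choiceType) (F : I -> J -> R) :
  abs_summable (uncur (fun j i => F i j)) = abs_summable (uncur F).
Proof. by rewrite uncur_swap abs_summable_reindex//; exact: swap_bij. Qed.

Lemma norm1_swap (I J : choiceType) (F : I -> J -> R) :
  norm1 (uncur (fun j i => F i j)) = norm1 (uncur F).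
Proof. by rewrite uncur_swap norm1_reindex//; exact: swap_bij. Qed.

Lemma usum_swap (I J : choiceType) (F : I -> J -> R) :
  abs_summable (uncur F) ->
  usum (fun i => usum (F i)) = usum (fun j => usum (F^~ j)).
Proof.
move=> s; have [_ <-] := usum_pair s.
move: (s); rewrite -summable_swap => /usum_pair[_ <-].
by rewrite uncur_swap usum_reindex//; exact: swap_bij.
Qed.

End unordered_sum.

Section cauchy_pointwise.
Context {R : realType} {V : normedModType R} {J : Type}.
Variables (ev : V -> J -> R) (C : J -> R).
Hypothesis evC : forall u v j, `|ev u j - ev v j| <= C j * `|u - v|.
Context (F : set_system V) {FF : ProperFilter F}.
Hypothesis cF : cauchy F.

Lemma cauchy_small (e : R) : 0 < e ->
  exists2 A, F A & forall u v, A u -> A v -> `|u - v| <= e.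
Proof.
move=> e0; have e20 : 0 < e / 2 by rewrite divr_gt0.
have /cauchyP /(_ _ e20)[w Fw] := cF.
exists (ball w (e / 2)) => // u v; rewrite -ball_normE /ball_/= => wu wv.
rewrite -(subrKA w u (- v)) [e]splitr (le_trans (ler_normD _ _))//.
by rewrite lerD// ltW// distrC.
Qed.

Lemma cauchy_pointwise : exists phi : J -> R,
  forall j, (ev u j : R^o) @[u --> F] --> (phi j : R^o).
Proof.
suff H j : cvg ((ev u j : R^o) @[u --> F]).
  exists (fun j => lim ((ev u j : R^o) @[u --> F])) => j; exact: H.
apply/cauchy_cvgP/cauchyP => e e0.
have d0 : 0 < e / (`|C j| + 1) by rewrite divr_gt0// ltr_wpDl.
have [A FA Ad] := cauchy_small d0. have [a Aa] := filter_ex FA.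
exists (ev a j); change (F [set u | ball (ev a j : R^o) e (ev u j)]).
apply: filterS FA => u Au; rewrite /= -ball_normE /ball_/=.
have c0 : 0 < `|C j| + 1 by rewrite ltr_wpDl.
apply: le_lt_trans (evC _ _ _) _.
apply: (@le_lt_trans _ _ (`|C j| * (e / (`|C j| + 1)))).
  apply: le_trans (ler_wpM2r (normr_ge0 _) (ler_norm _)) _.
  by rewrite ler_wpM2l// Ad.
by rewrite mulrCA gtr_pMr// ltr_pdivrMr// mul1r ltrDl.
Qed.

End cauchy_pointwise.

Section l1.
Variables (R : realType) (I : choiceType).

Definition l1_pred : {pred I -> R^o} := fun f => @abs_summable R I f.

Record l1 := L1 { l1_fun :> I -> R^o; l1P : l1_fun \in l1_pred }.

HB.instance Definition _ := [isSub for l1_fun].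
HB.instance Definition _ := [Choice of l1 by <:].

Lemma l1_submod_closed : submod_closed l1_pred.
Proof.
split; first exact: abs_summable0.
move=> c f g sf sg.
exact: (@abs_summableD R I _ _ (@abs_summableZ R I c f sf) sg).
Qed.

HB.instance Definition _ :=
  GRing.isSubmodClosed.Build _ _ l1_pred (GRing.submod_closed_semi l1_submod_closed).
HB.instance Definition _ := [SubChoice_isSubLmodule of l1 by <:].

Lemma l1_summable (f : l1) : @abs_summable R I f. Proof. exact: l1P. Qed.

Definition l1_norm (f : l1) : R := @norm1 R I f.

Lemma l1_ler_normD (f g : l1) : l1_norm (f + g) <= l1_norm f + l1_norm g.
Proof. exact: (norm1D (l1_summable f) (l1_summable g)). Qed.

Lemma l1_normrZ (c : R) (f : l1) : l1_norm (c *: f) = `|c| * l1_norm f.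
Proof. exact: (norm1Z c (l1_summable f)). Qed.

Lemma l1_normr0_eq0 (f : l1) : l1_norm f = 0 -> f = 0.
Proof. by move=> /(norm1_eq0 (l1_summable f)) f0; apply: val_inj. Qed.

HB.instance Definition _ :=
  Lmodule_isNormed.Build R l1 l1_ler_normD l1_normrZ l1_normr0_eq0.

Lemma l1_normE (f : l1) : `|f| = @norm1 R I f. Proof. by []. Qed.

Lemma l1_complete (F : set_system l1) : ProperFilter F -> cauchy F -> cvg F.
Proof.
move=> FF cF.
have evC (u v : l1) (i : I) : `|(u i : R) - v i| <= 1 * `|u - v|.
  by rewrite mul1r; exact: (norm1_ge1 i (l1_summable (u - v))).
have [phi phiE] := cauchy_pointwise evC cF.
have tail (e : R) : 0 < e -> exists2 A, F A & forall u, A u ->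
    @abs_summable R I (fun i => u i - phi i) /\
    norm1 (fun i => (u i : R) - phi i) <= e.
  move=> e0; have [A FA Ad] := cauchy_small cF e0; exists A => // u Au.
  apply: ge_norm1 => B.
  have cB : (\sum_(i <- B) `|(u i : R) - (v : l1) i| : R^o) @[v --> F] -->
            (\sum_(i <- B) `|(u i : R) - phi i| : R^o).
    elim: (enum_fset B) => [|i s IH].
      under eq_fun do rewrite big_nil; rewrite big_nil; exact: cvg_cst.
    under eq_fun do rewrite big_cons; rewrite big_cons.
    apply: cvgD => //; apply: cvg_norm; apply: cvgB; first exact: cvg_cst.
    exact: phiE.
  apply: (cvgr_to_le cB); apply: filterS FA => v Av.
  by apply: le_trans (Ad _ _ Au Av); exact: (norm1_ge B (l1_summable (u - v))).
have sphi : @abs_summable R I phi.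
  have [A FA Ad] := tail _ ltr01; have [u Au] := filter_ex FA.
  have [s _] := Ad _ Au.
  have := abs_summableD (l1_summable u) (abs_summableN s).
  by congr (is_true (abs_summable _)); apply/funext => i; rewrite opprB subrKC.
apply/cvg_ex; exists (L1 sphi).
apply/cvgrPdistC_le => e e0; have [A FA Ad] := tail _ e0.
by apply: filterS FA => u Au; exact: (Ad u Au).2.
Qed.

HB.instance Definition _ := Uniform_isComplete.Build l1 l1_complete.

End l1.

Section delta.
Context {R : realType} {I : choiceType}.

Lemma delta_summable (i : I) : @abs_summable R I (fun j => (j == i)%:R).
Proof.
apply: (@usum_fin R I _ [fset i]%fset _).1 => j.
by rewrite inE => /negbTE ->.
Qed.

Definition delta (i : I) : l1 R I := L1 (delta_summable i).

Lemma deltaE i j : delta i j = (j == i)%:R.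
Proof. by []. Qed.

Lemma norm_delta i : `|delta i| = 1.
Proof.
rewrite l1_normE -usum_ge0//; last exact: delta_summable.
rewrite (@usum_fin R I _ [fset i]%fset _).2; last first.
  by move=> j; rewrite inE deltaE => /negbTE ->.
by rewrite big_seq_fset1 deltaE eqxx.
Qed.

End delta.

Section bounded_linear.
Context {R : realType} {V W : normedModType R}.

Lemma linear_bound_continuous (f : {linear V -> W}) (M : R) :
  (forall x, `|f x| <= M * `|x|) -> continuous f.
Proof.
move=> fM; apply/linear_bounded_continuous/linear_boundedP.
near=> r => x; apply: le_trans (fM x) _; apply: ler_wpM2r => //.
by near: r; apply: nbhs_pinfty_ge; exact: num_real.
Unshelve. all: by end_near. Qed.

Lemma continuous_linear_bound (f : {linear V -> W}) : continuous f ->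
  exists2 M, 0 <= M & forall x, `|f x| <= M * `|x|.
Proof.
move=> /linear_bounded_continuous/linear_boundedP.
move=> /pinfty_ex_gt0[M M0 fM]; exists M => //; exact: ltW.
Qed.

End bounded_linear.

Section dual.
Variables (R : realType) (V : normedModType R).

Definition dual_pred : {pred V -> R^o} :=
  fun f => `[< linear f /\ continuous f >].

Record dual := Dual { dual_fun :> V -> R^o; dualP : dual_fun \in dual_pred }.

HB.instance Definition _ := [isSub for dual_fun].
HB.instance Definition _ := [Choice of dual by <:].

Lemma dual_submod_closed : submod_closed dual_pred.
Proof.
split.
  apply/asboolP; split; last exact: cst_continuous.
  by move=> c u v; rewrite /= scaler0 addr0.
move=> c f g /asboolP[lf cf] /asboolP[lg cg]; apply/asboolP; split.
  move=> k u v; rewrite !fctE lf lg !scalerDr !scalerA mulrC.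
  by rewrite addrACA.
rewrite (_ : c *: f + g = fun x => c *: f x + g x)// => x.
apply: (@cvgD _ _ _ _ _ (fun x => c *: f x) g); last exact: cg.
by apply: cvgZl_tmp; exact: cf.
Qed.

HB.instance Definition _ :=
  GRing.isSubmodClosed.Build _ _ dual_pred (GRing.submod_closed_semi dual_submod_closed).
HB.instance Definition _ := [SubChoice_isSubLmodule of dual by <:].

Section linear.
Variable f : dual.

Lemma dual_linear : linear f. Proof. by have /asboolP[] := dualP f. Qed.

HB.instance Definition _ := GRing.isLinear.Build R V R^o *:%R f dual_linear.

Lemma dual_continuous : continuous f.
Proof. by have /asboolP[] := dualP f. Qed.

End linear.

Definition dual_norm (f : dual) : R :=
  sup [set `|f x| | x in [set x : V | `|x| <= 1]].

Lemma dual_norm_ub (f : dual) :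
  has_sup [set `|f x| | x in [set x : V | `|x| <= 1]].
Proof.
split; first by exists `|f 0|, 0 => //=; rewrite normr0.
have [M M0 fM] := continuous_linear_bound (@dual_continuous f).
exists M => _ [x /= x1 <-]; apply: le_trans (fM x) _.
by rewrite -[leRHS]mulr1 ler_wpM2l.
Qed.

Lemma dual_norm_ge0 (f : dual) : 0 <= dual_norm f.
Proof.
apply: le_trans (normr_ge0 (f 0)) _.
by apply: (ub_le_sup (dual_norm_ub f).2); exists 0 => //=; rewrite normr0.
Qed.

Lemma dual_norm_bound (f : dual) x : `|f x| <= dual_norm f * `|x|.
Proof.
have [->|x0] := eqVneq x 0; first by rewrite linear0 !normr0 mulr0.
have nx : 0 < `|x| by rewrite normr_gt0.
rewrite -ler_pdivrMr// mulrC -[X in X * _](@ger0_norm R); last first.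
  by rewrite invr_ge0 ltW.
rewrite -normrM -[_ * _]/(_ *: _) -linearZ.
apply: (ub_le_sup (dual_norm_ub f).2); eexists; last reflexivity.
by rewrite /= normrZ ger0_norm ?invr_ge0// mulVf// normr_eq0.
Qed.

Lemma dual_norm_le (f : dual) (M : R) :
  0 <= M -> (forall x, `|f x| <= M * `|x|) -> dual_norm f <= M.
Proof.
move=> M0 fM; apply: ge_sup; first exact: (dual_norm_ub f).1.
move=> _ [x /= x1 <-]; apply: le_trans (fM x) _.
by rewrite -[leRHS]mulr1 ler_wpM2l.
Qed.

Lemma dual_ler_normD (f g : dual) : dual_norm (f + g) <= dual_norm f + dual_norm g.
Proof.
apply: dual_norm_le => [|x]; first by rewrite addr_ge0 ?dual_norm_ge0.
apply: le_trans (ler_normD _ _) _.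
by rewrite mulrDl lerD ?dual_norm_bound.
Qed.

Lemma dual_normrZ (c : R) (f : dual) : dual_norm (c *: f) = `|c| * dual_norm f.
Proof.
have le k (g : dual) : dual_norm (k *: g) <= `|k| * dual_norm g.
  apply: dual_norm_le => [|x]; first by rewrite mulr_ge0 ?dual_norm_ge0.
  by rewrite normrM -mulrA ler_wpM2l ?dual_norm_bound.
apply/eqP; rewrite eq_le le/=; have [->|c0] := eqVneq c 0.
  by rewrite normr0 mul0r dual_norm_ge0.
have := le c^-1 (c *: f); rewrite scalerA mulVf// scale1r.
by rewrite normfV ler_pdivlMl// normr_gt0.
Qed.

Lemma dual_normr0_eq0 (f : dual) : dual_norm f = 0 -> f = 0.
Proof.
move=> f0; apply: val_inj; apply/funext => x; apply/eqP.
by rewrite -normr_le0 (le_trans (dual_norm_bound _ _))// f0 mul0r.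
Qed.

HB.instance Definition _ :=
  Lmodule_isNormed.Build R dual dual_ler_normD dual_normrZ dual_normr0_eq0.

Lemma dual_normE (f : dual) :
  `|f| = sup [set `|f x| | x in [set x : V | `|x| <= 1]].
Proof. by []. Qed.

Lemma ler_dual_norm (f : dual) x : `|f x| <= `|f| * `|x|.
Proof. exact: dual_norm_bound. Qed.

Lemma dual_complete (F : set_system dual) :
  ProperFilter F -> cauchy F -> cvg F.
Proof.
move=> FF cF.
have evC (f g : dual) (x : V) : `|(f x : R) - g x| <= `|x| * `|f - g|.
  by rewrite mulrC; exact: (dual_norm_bound (f - g)).
have [phi phiE] := cauchy_pointwise evC cF.
have lphi : linear (phi : V -> R^o).
  move=> c x y; apply: (@cvg_unique _ (@norm_hausdorff _ R^o) _ _ _ _ (phiE _)).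
  rewrite (_ : (fun u => _) = fun u : dual => c *: u x + u y); last first.
    by apply/funext => u; exact: dual_linear.
  apply: (@cvgD _ R^o); last exact: phiE.
  by apply: (@cvgZl_tmp _ R^o); exact: phiE.
pose lp := GRing.isLinear.Build R V R^o *:%R phi lphi.
pose L : {linear V -> R^o} := HB.pack phi lp.
have tail (e : R) : 0 < e -> exists2 A, F A & forall f, A f ->
    forall x, `|(f x : R) - phi x| <= e * `|x|.
  move=> e0; have [A FA Ad] := cauchy_small cF e0; exists A => // f Af x.
  have cx : (`|(f x : R) - (g : dual) x| : R^o) @[g --> F] -->
            (`|(f x : R) - phi x| : R^o).
    apply: cvg_norm; apply: cvgB; first exact: cvg_cst.
    exact: phiE.
  apply: (cvgr_to_le cx); apply: filterS FA => g Ag.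
  apply: le_trans (evC _ _ _) _.
  by rewrite mulrC ler_wpM2r// Ad.
have cphi : continuous (phi : V -> R^o).
  have [A FA Ad] := tail _ ltr01; have [f Af] := filter_ex FA.
  apply: (@linear_bound_continuous R V R^o L (1 + `|f|)) => x.
  rewrite /= -(subrKC (f x) (phi x)) (le_trans (ler_normD _ _))//.
  by rewrite mulrDl addrC lerD ?dual_norm_bound// distrC Ad.
have pP : phi \in dual_pred by apply/asboolP.
apply/cvg_ex; exists (Dual pP).
apply/cvgrPdistC_le => e e0; have [A FA Ad] := tail _ e0.
apply: filterS FA => f Af; apply: dual_norm_le; first exact: ltW.
by move=> x; exact: Ad.
Qed.

HB.instance Definition _ := Uniform_isComplete.Build dual dual_complete.

End dual.

(* A Banach algebra need not have a unit. *)
HB.mixin Record isBanachAlgebra (R : realType) A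
    of CompleteNormedModule R A := {
  bmul : A -> A -> A;
  bmulA : associative bmul;
  bmulDl : left_distributive bmul +%R;
  bmulDr : right_distributive bmul +%R;
  bmulZl : forall (c : R) (x y : A), bmul (c *: x) y = c *: bmul x y;
  bmulZr : forall (c : R) (x y : A), bmul x (c *: y) = c *: bmul x y;
  ler_norm_bmul : forall x y : A, `|bmul x y| <= `|x| * `|y|
}.

#[short(type="banachAlgType")]
HB.structure Definition BanachAlgebra (R : realType) :=
  {A of isBanachAlgebra R A & CompleteNormedModule R A}.

Section group_algebra.
Variables (R : realType) (G : groupType).
Implicit Types a b c : l1 R G.

(* The sum of [a s * b t] over all [s], [t] with [s * t = x]. *)
Definition conv a b (x : G) : R := usum (fun s : G => a s * b (s^-1 * x)%g).

Let mulg_bij (s : G) : bijective (fun x : G => s * x)%g.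
Proof.
by exists (fun x => s^-1 * x)%g => x; rewrite mulgA
  ?mulVg ?mulgV mul1g.
Qed.

Let ker a b (s x : G) : R := a s * b (s^-1 * x)%g.

Let shiftE b (s : G) : abs_summable (fun x => (b (s^-1 * x)%g : R)) /\
  norm1 (fun x => (b (s^-1 * x)%g : R)) = `|b|.
Proof.
split; first by rewrite (abs_summable_reindex (mulg_bij _)) l1_summable.
exact: (norm1_reindex (mulg_bij _)).
Qed.

Let ker_norm a b : abs_summable (uncur (ker a b)) /\
  norm1 (uncur (ker a b)) = `|a| * `|b|.
Proof.
have sk s : abs_summable (ker a b s) by apply: abs_summableZ; exact: (shiftE b s).1.
have nk s : norm1 (ker a b s) = `|b| * `|a s|.
  by rewrite norm1Z ?(shiftE b s).1// (shiftE b s).2 mulrC.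
have E : (fun s => norm1 (ker a b s)) = fun s => `|b| * `|a s|.
  by apply/funext.
have sa : abs_summable (fun s => `|(a s : R)|).
  by rewrite abs_summable_abs l1_summable.
have s : abs_summable (uncur (ker a b)).
  by apply: pair_summable => //; rewrite E; exact: abs_summableZ.
split=> //; have [_ _ ->] := summable_pair s.
by rewrite E norm1Z// normr_id norm1_abs mulrC.
Qed.

Let ker_summable a b x : abs_summable (fun s => ker a b s x).
Proof.
have [] := ker_norm a b; rewrite -summable_swap => s _.
by have [] := summable_pair s.
Qed.

Lemma conv_summable a b : abs_summable (conv a b).
Proof.
have [] := ker_norm a b; rewrite -summable_swap => s _.
by have [] := usum_pair s.
Qed.

Definition l1_mul a b : l1 R G := L1 (conv_summable a b).

Lemma l1_mulDl : left_distributive l1_mul +%R.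
Proof.
move=> a b c; apply: val_inj; apply/funext => x.
rewrite /= -[RHS]/(conv a c x + conv b c x) /conv -usumD; last 2 first.
- exact: ker_summable.
- exact: ker_summable.
by congr usum; apply/funext => s; exact: mulrDl.
Qed.

Lemma l1_mulDr : right_distributive l1_mul +%R.
Proof.
move=> a b c; apply: val_inj; apply/funext => x.
rewrite /= -[RHS]/(conv a b x + conv a c x) /conv -usumD; last 2 first.
- exact: ker_summable.
- exact: ker_summable.
by congr usum; apply/funext => s; exact: mulrDr.
Qed.

Lemma l1_mulZl (k : R) a b : l1_mul (k *: a) b = k *: l1_mul a b.
Proof.
apply: val_inj; apply/funext => x.
rewrite /= -[RHS]/(k * conv a b x) /conv -usumZ; last exact: ker_summable.
by congr usum; apply/funext => s; rewrite mulrA.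
Qed.

Lemma l1_mulZr (k : R) a b : l1_mul a (k *: b) = k *: l1_mul a b.
Proof.
apply: val_inj; apply/funext => x.
rewrite /= -[RHS]/(k * conv a b x) /conv -usumZ; last exact: ker_summable.
by congr usum; apply/funext => s; exact: mulrCA.
Qed.

Lemma l1_ler_mul a b : `|l1_mul a b| <= `|a| * `|b|.
Proof.
have [s <-] := ker_norm a b; rewrite -norm1_swap.
move: s; rewrite -summable_swap => s; have [sk snk ->] := summable_pair s.
apply: norm1_le => // x.
rewrite [leRHS]ger0_norm ?norm1_ge0//; exact: (ler_usum (sk x)).
Qed.

Lemma l1_mulA : associative l1_mul.
Proof.
move=> a b c; apply: val_inj; apply/funext => x; rewrite /=.
pose T (t s : G) : R := a t * b (t^-1 * s)%g * c (s^-1 * x)%g.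
have sT : abs_summable (uncur T).
  apply: abs_summable_le (abs_summableZ `|c| (ker_norm a b).1) => -[t s] /=.
  rewrite /uncur /T /ker /= !normrM normr_id mulrC ler_wpM2r// ?mulr_ge0//.
  exact: (norm1_ge1 _ (l1_summable c)).
transitivity (usum (fun t => usum (T t))).
  congr usum; apply/funext => t; rewrite /= /conv.
  rewrite -usumZ; last exact: ker_summable.
  rewrite -(usum_reindex (mulg_bij t^-1%g)).
  congr usum; apply/funext => s; rewrite /T /= mulrA; congr (_ * c _).
  rewrite invgM invgK.
  by rewrite mulgA mulgK.
rewrite usum_swap//; congr usum; apply/funext => s.
rewrite /= mulrC -usumZ; last exact: ker_summable.
by congr usum; apply/funext => t; rewrite /T mulrC.
Qed.

HB.instance Definition _ := isBanachAlgebra.Build R (l1 R G)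
  l1_mulA l1_mulDl l1_mulDr l1_mulZl l1_mulZr l1_ler_mul.

Lemma l1_mulE a b x :
  (bmul a b : l1 R G) x = usum (fun s : G => a s * b (s^-1 * x)%g).
Proof. by []. Qed.

Lemma bmul_delta (s t : G) : bmul (delta s) (delta t) = delta (s * t)%g :> l1 R G.
Proof.
apply: val_inj; apply/funext => x; rewrite /= /conv.
rewrite (@usum_fin R G _ [fset s]%fset _).2; last first.
  by move=> u; rewrite inE deltaE => /negbTE ->; rewrite mul0r.
rewrite big_seq_fset1 !deltaE eqxx mul1r; congr (nat_of_bool _)%:R.
apply/eqP/eqP => [<-|->].
  by rewrite mulgA mulgV mul1g.
by rewrite mulgA mulVg mul1g.
Qed.

End group_algebra.

Section rosenthal.
Context {R : realType}.

(* [T] is a linear homeomorphism of [V] onto the subspace [range T] of [W],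
   with inverse [S]. *)
Definition contains_copy (V W : normedModType R) :=
  exists (T : {linear V -> W}) (S : W -> V),
    [/\ continuous T, cancel T S & {within range T, continuous S}].

Definition rosenthal_space (V : completeNormedModType R) :=
  ~ contains_copy (l1 R nat) V.

Definition rosenthal_operator (V1 V2 : completeNormedModType R)
    (T : V1 -> V2) :=
  exists (V3 : completeNormedModType R)
         (alpha : {linear V1 -> V3}) (beta : {linear V3 -> V2}),
    [/\ rosenthal_space V3, continuous alpha, continuous beta &
        T = beta \o alpha].

End rosenthal.

Section tame_functional.
Context {R : realType} {A : banachAlgType R}.
Implicit Types (lam : dual A) (a x : A).

Lemma bmul_linear a : linear (bmul a).
Proof. by move=> c x y; rewrite bmulDr bmulZr. Qed.

Lemma dual_act_subproof lam a : (fun x => lam (bmul a x)) \in @dual_pred R A.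
Proof.
have lin : linear (fun x => lam (bmul a x) : R^o).
  by move=> c x y; rewrite bmul_linear dual_linear.
apply/asboolP; split=> //.
pose l := GRing.isLinear.Build R A R^o *:%R _ lin.
pose L : {linear A -> R^o} := HB.pack (fun x => lam (bmul a x) : R^o) l.
apply: (@linear_bound_continuous R A R^o L (`|lam| * `|a|)) => x.
apply: le_trans (ler_dual_norm lam _) _.
by rewrite -mulrA ler_wpM2l// ler_norm_bmul.
Qed.

Definition dual_act lam a : dual A := Dual (dual_act_subproof lam a).

Lemma dual_actE lam a x : dual_act lam a x = lam (bmul a x).
Proof. by []. Qed.

Lemma dual_act_linear lam : linear (dual_act lam).
Proof.
move=> c a b; apply: val_inj; apply/funext => x.
by rewrite /= bmulDl bmulZl dual_linear.
Qed.

HB.instance Definition _ lam :=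
  GRing.isLinear.Build R A (dual A) *:%R (dual_act lam) (dual_act_linear lam).

Lemma dual_act_continuous lam : continuous (dual_act lam).
Proof.
apply: (@linear_bound_continuous R A (dual A) (dual_act lam) `|lam|) => a.
apply: dual_norm_le => [|x]; first by rewrite mulr_ge0.
apply: le_trans (ler_dual_norm lam _) _.
by rewrite -mulrA ler_wpM2l// ler_norm_bmul.
Qed.

Definition tame_functional lam := rosenthal_operator (dual_act lam).

End tame_functional.

Section tame_function.
Context {R : realType}.

Definition independent (X : Type) (f : nat -> X -> R) :=
  exists a b : R, a < b /\
    forall P M : set nat, finite_set P -> finite_set M -> P `&` M = set0 ->
      (\bigcap_(n in P) (f n @^-1` [set r | r < a])) `&`
      (\bigcap_(n in M) (f n @^-1` [set r | b < r])) !=set0.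

Definition tame_family (X : Type) (F : set (X -> R)) :=
  (exists M : R, forall f, F f -> forall x, `|f x| <= M) /\
  ~ (exists f : nat -> X -> R, (forall n, F (f n)) /\ independent f).

Definition translates (G : groupType) (f : G -> R) : set (G -> R) :=
  [set fun t => f (s * t)%g | s in [set: G]].

Definition tame_function (G : groupType) (f : G -> R) :=
  (exists M : R, forall t, `|f t| <= M) /\ tame_family (translates f).

End tame_function.

Section canonical_isomorphism.
Context {R : realType} {I : choiceType}.
Implicit Types (f : dual (l1 R I)) (phi : I -> R).

Lemma dual_l1_bounded f i : `|f (delta i)| <= `|f|.
Proof. by have := ler_dual_norm f (delta i); rewrite norm_delta mulr1. Qed.

Lemma dual_l1_eq0 f : (forall i, f (delta i) = 0) -> f = 0.
Proof.
move=> f0; suff fE a : f a = 0 by apply: val_inj; apply/funext.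
apply/eqP; rewrite -normr_le0.
apply/ler_addgt0Pl => e e0; rewrite addr0.
have d0 : 0 < e / (`|f| + 1) by rewrite divr_gt0// ltr_wpDl.
have [A tA] := norm1_tail (l1_summable a) d0.
pose aA : l1 R I := \sum_(i <- A) a i *: delta i.
have faA : f aA = 0 by rewrite linear_sum big1// => i _; rewrite linearZ /= f0 scaler0.
have aE j : aA j = if j \in A then a j else 0.
  rewrite -[aA j]/((\val aA : I -> R^o) j) raddf_sum fct_sumE.
  rewrite (eq_bigr (fun i => a i * (j == i)%:R))//.
  case: ifPn => jA.
    rewrite (big_fsetD1 j)//= eqxx mulr1 big1_fset ?addr0// => i.
    by rewrite !inE eq_sym => /andP[/negbTE -> _]; rewrite mulr0.
  rewrite big1_seq// => i /andP[_ iA]; case: eqP => [ji|]; last by rewrite mulr0.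
  by rewrite ji iA in jA.
rewrite -[f a]subr0 -faA -raddfB.
apply: le_trans (ler_dual_norm f _) _.
have nt : `|a - aA| <= e / (`|f| + 1).
  apply: le_trans tA; rewrite l1_normE le_eqVlt; apply/orP; left; apply/eqP.
  congr norm1; apply/funext => j; rewrite -[LHS]/(a j - aA j) aE.
  by case: ifP; rewrite ?subrr ?subr0.
apply: (@le_trans _ _ (`|f| * (e / (`|f| + 1)))); first by rewrite ler_wpM2l.
by rewrite mulrCA ger_pMr// ler_pdivrMr ?ltr_wpDl// mul1r lerDl.
Qed.

Lemma summable_mul_bounded phi (M : R) (a : l1 R I) :
  0 <= M -> (forall i, `|phi i| <= M) ->
  abs_summable (fun i => (a i : R) * phi i) /\
  norm1 (fun i => (a i : R) * phi i) <= M * `|a|.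
Proof.
move=> M0 phiM; apply: ge_norm1 => A.
apply: (@le_trans _ _ (\sum_(i <- A) M * `|(a i : R)|)).
  by apply: ler_sum => i _; rewrite normrM mulrC ler_wpM2r.
by rewrite -mulr_sumr ler_wpM2l// (norm1_ge A (l1_summable a)).
Qed.

Lemma dual_of_bounded phi (M : R) : 0 <= M -> (forall i, `|phi i| <= M) ->
  exists2 f : dual (l1 R I), `|f| <= M & forall i, f (delta i) = phi i.
Proof.
move=> M0 phiM; pose g (a : l1 R I) : R^o := usum (fun i => (a i : R) * phi i).
have sg a := (summable_mul_bounded a M0 phiM).1.
have lin : linear g.
  move=> c a b; rewrite -[RHS]/(c * g a + g b) /g -usumZ// -usumD ?abs_summableZ//.
  by congr usum; apply/funext => i; rewrite mulrA -mulrDl.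
pose l := GRing.isLinear.Build R (l1 R I) R^o *:%R _ lin.
pose L : {linear l1 R I -> R^o} := HB.pack g l.
have gM a : `|g a| <= M * `|a|.
  exact: le_trans (ler_usum (sg a)) (summable_mul_bounded a M0 phiM).2.
have gP : g \in @dual_pred R (l1 R I).
  by apply/asboolP; split=> //; exact: (@linear_bound_continuous R _ _ L M gM).
exists (Dual gP) => [|i]; first exact: dual_norm_le.
rewrite /= /g (@usum_fin R I _ [fset i]%fset _).2.
  by rewrite big_seq_fset1 deltaE eqxx mul1r.
by move=> j; rewrite inE deltaE => /negbTE ->; rewrite mul0r.
Qed.

(* The map [f |-> f \o delta], which is clearly linear, is an isometric
   bijection from the dual of [l1 R I] onto the bounded functions on [I]. *)
Lemma dual_l1_bij phi : (exists M : R, forall i, `|phi i| <= M) ->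
  exists! f : dual (l1 R I), f \o delta = phi :> (I -> R).
Proof.
move=> [M phiM]; have phiM' i : `|phi i| <= `|M|.
  exact: le_trans (phiM i) (ler_norm M).
have [f _ fE] := dual_of_bounded (normr_ge0 M) phiM'.
exists f; split=> [|g gE]; first by apply/funext => i; exact: fE.
apply/eqP; rewrite -subr_eq0; apply/eqP/dual_l1_eq0 => i.
rewrite -[LHS]/(f (delta i) - g (delta i)) fE -gE; exact: subrr.
Qed.

Lemma dual_l1_isometry f : `|f| = sup (range (fun i => `|f (delta i)| : R)).
Proof.
set S := range _.
have S_ub : has_ubound S by exists `|f| => _ [i _ <-]; exact: dual_l1_bounded.
have le_sup i : `|f (delta i)| <= sup S by apply: ub_le_sup => //; exists i.
have [S0|S0] := eqVneq S set0.
  have f0 : f = 0.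
    apply: dual_l1_eq0 => i; exfalso.
    by have : S `|f (delta i)| by [exists i]; rewrite S0.
  by rewrite S0 sup0 f0 normr0.
have /set0P[_ [i0 _ _]] := S0.
apply/eqP; rewrite eq_le; apply/andP; split; last first.
  by apply: ge_sup; [exact/set0P|move=> _ [i _ <-]; exact: dual_l1_bounded].
have M0 : 0 <= sup S by apply: le_trans (le_sup i0).
have [g gM gE] := dual_of_bounded M0 le_sup.
suff -> : f = g by [].
apply/eqP; rewrite -subr_eq0; apply/eqP/dual_l1_eq0 => i.
by rewrite -[LHS]/(f (delta i) - g (delta i)) gE; exact: subrr.
Qed.

End canonical_isomorphism.

(* Main.v *)
(** For the direct implication, an independent sequence of translates spans a
    copy of l1 in l_infinity, which pulls back to any space through which the
    operator [T : a |-> f . a] factors.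

    For the converse, [T] is factored through the c0-version of the
    Davis-Figiel-Johnson-Pelczynski interpolation space: the [y] in the dual for
    which [inf_x (2^-n |x| + 2^n |y - T x|)] tends to 0, with the sup norm of
    this sequence. If it contains l1, a gliding hump shows that some tail of the
    basis still spans l1 in the dual norm, and its vectors are uniformly
    approximated by bounded combinations of translates of [phi = f o delta].
    Averaging over signs, Hahn-Banach provides a finitely additive mean [m]
    separating these vectors in L1(m); hence the translates are not totally
    bounded in L1(m), and some ultrafilter [U] of translates is separated in
    L1(m). For suitable levels [a < b], the sets [{phi s < a}] and [{phi s > b}]
    then cannot be made simultaneously [U]-small on complementary pieces of the
    group, and an exhaustion argument shows that this survives intersection with
    [{phi s < a}], or with [{phi s > b}], for [U]-almost all [s]; this selects an
    independent sequence. *)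

Require Import Defs.
From HB Require Import structures.
From mathcomp Require Import all_boot all_order all_algebra finmap.
From mathcomp Require Import boolp classical_sets functions cardinality reals.
From mathcomp Require Import topology normedtype numfun.
From mathcomp Require Import monoid lra ring.

Set Implicit Arguments.
Unset Strict Implicit.
Unset Printing Implicit Defensive.

Import Order.TTheory GRing.Theory Num.Theory.
Import numFieldNormedType.Exports.

Local Open Scope classical_set_scope.
Local Open Scope ring_scope.

(** * Hahn-Banach *)

Section inf.
Context {R : realType} (T : Type) (P : set T).
Implicit Type F : T -> R.

Definition inf_over F : R := inf (F @` P).

Lemma inf_over_le F (b : R) t : (forall s, P s -> b <= F s) -> P t ->
  inf_over F <= F t.
Proof.
by move=> bF Pt; apply: ge_inf; [exists b => _ [s Ps <-]; exact: bF|exists t].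
Qed.

Lemma le_inf_over F (b : R) : P !=set0 -> (forall s, P s -> b <= F s) ->
  b <= inf_over F.
Proof.
by move=> [t Pt] bF; apply: lb_le_inf; [exists (F t), t|move=> _ [s Ps <-]; exact: bF].
Qed.

End inf.

Section hahn_banach.
Context {R : realType} {V : lmodType R}.
Implicit Types (p q : V -> R) (x y : V).

(** Homogeneity is asked as an inequality because this is what passes directly to infima; applying
    it to [c^-1] recovers equality. *)
Definition sublinear p :=
  (forall x y, p (x + y) <= p x + p y) /\
  (forall (c : R) x, 0 < c -> p (c *: x) <= c * p x).

Lemma sublinear0 p : sublinear p -> p 0 = 0.
Proof.
move=> [_ pZ]; apply/eqP; rewrite eq_le; apply/andP; split.
  by have := pZ 2^-1 0 ltac:(by rewrite invr_gt0); rewrite scaler0; lra.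
by have := pZ 2 0 ltac:(by []); rewrite scaler0; lra.
Qed.

Lemma sublinearZ p (c : R) x : sublinear p -> 0 < c -> p (c *: x) = c * p x.
Proof.
move=> [_ pZ] c0; apply/eqP; rewrite eq_le pZ//=.
have := pZ c^-1 (c *: x) ltac:(by rewrite invr_gt0).
by rewrite scalerA mulVf ?gt_eqF// scale1r ler_pdivlMl.
Qed.

Lemma sublinearN p x : sublinear p -> - p (- x) <= p x.
Proof.
by move=> sp; have := sp.1 x (- x); rewrite subrr sublinear0//; lra.
Qed.

(* A cone of constraints [r <= m c] compatible with linear functionals [m <= p]. *)
Definition admissible_cone p (K : set (V * R)) :=
  [/\ K (0, 0), forall u v, K u -> K v -> K (u.1 + v.1, u.2 + v.2),
      forall (k : R) u, 0 < k -> K u -> K (k *: u.1, k * u.2) &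
      forall u, K u -> u.2 <= p u.1].

(** The infimum over [u] in [K] of [p (x + u.1) - u.2] is the largest sublinear functional below [p]
    with these bounds. A linear [m <= q] then satisfies [u.2 <= m u.1]. *)
Lemma sublinear_cone p K : sublinear p -> admissible_cone p K ->
  exists q, [/\ sublinear q, forall x, q x <= p x &
    forall u, K u -> q (- u.1) <= - u.2].
Proof.
move=> sp [K0 KD KZ Kp].
have lb x u : K u -> - p (- x) <= p (x + u.1) - u.2.
  move=> /Kp Ku; have := sp.1 (x + u.1) (- x).
  by rewrite addrAC subrr add0r; lra.
pose q x := inf_over K (fun u => p (x + u.1) - u.2).
have qle x u : K u -> q x <= p (x + u.1) - u.2.
  by move=> Ku; exact: (inf_over_le (lb x)).
have qge b x : (forall u, K u -> b <= p (x + u.1) - u.2) -> b <= q x.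
  by move=> H; apply: le_inf_over => //; exists (0, 0).
exists q; split; first split.
- move=> x y; rewrite -lerBlDr; apply: (qge) => u Ku.
  rewrite lerBlDr -lerBlDl; apply: (qge) => v Kv; rewrite lerBlDl.
  apply: le_trans (qle _ _ (KD _ _ Ku Kv)) _ => /=.
  by rewrite addrACA; have := sp.1 (x + u.1) (y + v.1); lra.
- move=> c x c0; rewrite -ler_pdivrMl//; apply: (qge) => u Ku.
  rewrite ler_pdivrMl//; apply: le_trans (qle _ _ (KZ _ _ c0 Ku)) _ => /=.
  by rewrite -scalerDr sublinearZ// mulrBr.
- by move=> x; have := qle x _ K0; rewrite /= addr0 subr0.
- move=> u Ku; apply: le_trans (qle _ _ Ku) _.
  by rewrite addNr sublinear0// sub0r.
Qed.

(* A minimal sublinear functional is odd, by [sublinear_cone] for the ray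
   [(t *: x, t * p x)], hence linear. *)
Lemma minimal_sublinear p : sublinear p ->
  (forall q, sublinear q -> (forall x, q x <= p x) -> q = p) ->
  linear (p : V -> R^o).
Proof.
move=> sp pmin.
have pN x : p (- x) = - p x.
  apply/eqP; rewrite eq_le; apply/andP; split; last first.
    by have := sublinearN x sp; lra.
  pose K := [set u | exists2 t : R, 0 <= t & u = (t *: x, t * p x)].
  have aK : admissible_cone p K.
    split.
    - by exists 0; rewrite ?scale0r ?mul0r.
    - move=> _ _ [s s0 ->] [t t0 ->]; exists (s + t); first exact: addr_ge0.
      by rewrite /= scalerDl mulrDl.
    - move=> k _ k0 [t t0 ->]; exists (k * t); first by rewrite mulr_ge0// ltW.
      by rewrite /= scalerA mulrA.
    - move=> _ [t t0 ->] /=; move: t0; rewrite le_eqVlt => /predU1P[<-|t0].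
        by rewrite mul0r scale0r sublinear0.
      by rewrite sublinearZ.
  have [q [sq qp /(_ (x, p x))]] := sublinear_cone sp aK.
  by rewrite (pmin q)//; apply; exists 1; rewrite ?scale1r ?mul1r.
(* Subadditivity at [- x] and [- y], read through oddness, is superadditivity at [x] and [y]. *)
have pD x y : p (x + y) = p x + p y.
  apply/eqP; rewrite eq_le sp.1/=.
  by have := sp.1 (- x) (- y); rewrite -opprD !pN; lra.
move=> c x y; rewrite pD; congr (_ + _).
have [c0|c0|->] := ltgtP c 0; last by rewrite !scale0r sublinear0.
- rewrite -[c]opprK scaleNr pN sublinearZ ?oppr_gt0//.
  by rewrite -[_ *: p x]/(- - c * p x) mulNr.
- exact: sublinearZ.
Qed.

(** Instead of extending from subspaces, Zorn's lemma runs over the sublinear functionals below [p],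
    ordered downwards: a maximal element is a minimal functional, hence linear. *)
Lemma hahn_banach p : sublinear p ->
  exists2 m : V -> R, linear (m : V -> R^o) & forall x, m x <= p x.
Proof.
move=> sp.
pose T := {q : V -> R | sublinear q /\ forall x, q x <= p x}.
pose r (s t : T) : bool := `[< forall x, sval t x <= sval s x >].
have [||||[q [sq qp]] qmin] := @Zorn T r.
- by move=> t; apply/asboolP.
- move=> s t u /asboolP st /asboolP tu; apply/asboolP => x.
  exact: le_trans (tu x) (st x).
- move=> [s ss] [t tt] /asboolP /= st /asboolP /= ts; apply: eq_exist.
  by apply/funext => x; apply/eqP; rewrite eq_le st ts.
- move=> A tot; have [[t0 At0]|A0] := pselect (A !=set0); last first.
    exists (exist _ p (conj sp (fun x => lexx _))) => s As.
    by exfalso; apply: A0; exists s.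
  have lb x (t : T) : A t -> - p (- x) <= sval t x.
    move: t => [q [sq qp]] _ /=; have := sublinearN x sq; have := qp (- x).
    by lra.
  pose q x := inf_over A (fun t : T => sval t x).
  have qle x t : A t -> q x <= sval t x by exact: inf_over_le (lb x).
  have qge b x : (forall t : T, A t -> b <= sval t x) -> b <= q x.
    by move=> H; apply: le_inf_over => //; exists t0.
  have qP : sublinear q /\ forall x, q x <= p x.
    split; first split.
    - move=> x y; rewrite -lerBlDr; apply: (qge) => s As.
      rewrite lerBlDr -lerBlDl; apply: (qge) => t At; rewrite lerBlDl.
      (* In a chain the smaller of [s] and [t] lies below both, which makes the pointwise infimum
         subadditive. *)
      have D (u : T) : A u -> sval u x <= sval s x -> sval u y <= sval t y ->
          q (x + y) <= sval s x + sval t y.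
        move=> Au us ut; apply: le_trans (qle _ _ Au) _.
        by case: u us ut {Au} => u [su _] /= us ut; have := su.1 x y; lra.
      have [/asboolP st|/asboolP ts] := tot _ _ As At.
      + exact: (D t).
      + exact: (D s).
    - move=> c x c0; rewrite -ler_pdivrMl//; apply: (qge) => s As.
      rewrite ler_pdivrMl//; apply: le_trans (qle _ _ As) _.
      by case: s {As} => s [ss _] /=; exact: ss.2.
    - move=> x; apply: le_trans (qle x _ At0) _.
      by case: t0 {At0 qge} => t [_ tp] /=.
  by exists (exist _ q qP) => s As; apply/asboolP => x /=; exact: qle.
exists q => //; apply: minimal_sublinear => // q' sq' q'q.
have q'p : forall x, q' x <= p x by move=> x; exact: le_trans (q'q x) (qp x).
have := qmin (exist _ q' (conj sq' q'p)).
by move=> /(_ ltac:(by apply/asboolP)) /(congr1 sval).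
Qed.

End hahn_banach.

(** * Means separating an l1-sequence *)

Section max_cut.
Context {R : realFieldType}.

(** Flipping the value at [i] is an involution exchanging the colourings that separate [i] from [j]
    with the others. *)
Lemma cut_average (N : nat) (i j : 'I_N) : i != j ->
  2 * \sum_(e : {ffun 'I_N -> bool}) (e i != e j)%:R =
  #|{ffun 'I_N -> bool}|%:R :> R.
Proof.
move=> ij.
pose flip (e : {ffun 'I_N -> bool}) := [ffun k => if k == i then ~~ e k else e k].
have flipK : involutive flip.
  by move=> e; apply/ffunP => k; rewrite !ffunE; case: eqP => // _; rewrite negbK.
rewrite mulr2n mulrDl mul1r [X in _ + X](reindex_inj (inv_inj flipK))/=.
rewrite -big_split/= -sum1_card natr_sum; apply: eq_bigr => e _.
rewrite !ffunE eqxx [j == i]eq_sym (negbTE ij).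
by case: (e i); case: (e j); rewrite /= ?addr0 ?add0r.
Qed.

(** A uniformly random two-colouring cuts each edge with probability 1/2, so some colouring cuts at
    least half of the total weight. *)
Lemma max_cut (L : seq (R * (nat * nat))) :
  (forall u, u \in L -> 0 <= u.1 /\ u.2.1 != u.2.2) ->
  exists e : nat -> bool,
    \sum_(u <- L) u.1 <= 2 * \sum_(u <- L) u.1 * (e u.2.1 != e u.2.2)%:R.
Proof.
(* [N] exceeds every vertex, so it is enough to average over the finitely many colourings of
   ['I_N]. *)
move=> LP; pose N := (\max_(u <- L) maxn u.2.1 u.2.2).+1.
have LN u : u \in L -> (u.2.1 < N)%N /\ (u.2.2 < N)%N.
  move=> uL; have := @leq_bigmax_seq _ L xpredT (fun u => maxn u.2.1 u.2.2) u uL erefl.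
  by rewrite geq_max /N => /andP[]; rewrite !ltnS.
pose ext (e : {ffun 'I_N -> bool}) (n : nat) := e (inord n).
apply: contrapT => /forallNP H.
pose C e : R := \sum_(u <- L) u.1 * (ext e u.2.1 != ext e u.2.2)%:R.
have lt e : 2 * C e < \sum_(u <- L) u.1 by rewrite ltNge; apply/negP; exact: H.
have : \sum_e 2 * C e < \sum_(e : {ffun 'I_N -> bool}) \sum_(u <- L) u.1.
  apply: ltr_sum => [|e _]; last exact: lt.
  by apply/hasP; exists [ffun=> true]; rewrite ?mem_index_enum.
rewrite -mulr_sumr exchange_big mulr_sumr [X in _ < X -> _]exchange_big/=.
rewrite [X in _ < X](eq_big_seq (fun u => 2 * \sum_e u.1 *
    (ext e u.2.1 != ext e u.2.2)%:R)) ?ltxx// => u uL.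
have [[l1 l2] [_ u12]] := (LN _ uL, LP _ uL).
rewrite -mulr_sumr mulrCA cut_average.
  by rewrite sumr_const mulr_natr.
by apply: contra u12 => /eqP /(congr1 val) /=; rewrite !inordK// => ->.
Qed.

End max_cut.

Section bounded_functions.
Variables (R : realType) (X : choiceType).

Definition bfun_pred : {pred X -> R^o} :=
  fun h => `[< exists b : R, forall t, `|h t| <= b >].

Record bfun := BFun { bfun_fun :> X -> R^o; bfunP : bfun_fun \in bfun_pred }.

HB.instance Definition _ := [isSub for bfun_fun].
HB.instance Definition _ := [Choice of bfun by <:].

Lemma bfun_submod_closed : submod_closed bfun_pred.
Proof.
split; first by apply/asboolP; exists 0 => t; rewrite normr0.
move=> c g h /asboolP[a ga] /asboolP[b hb]; apply/asboolP.
exists (`|c| * a + b) => t; apply: le_trans (ler_normD _ _) _.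
by rewrite lerD// normrM ler_wpM2l.
Qed.

HB.instance Definition _ :=
  GRing.isSubmodClosed.Build _ _ bfun_pred (GRing.submod_closed_semi bfun_submod_closed).
HB.instance Definition _ := [SubChoice_isSubLmodule of bfun by <:].

Lemma bfun_bounded (h : bfun) : exists b : R, forall t, `|h t| <= b.
Proof. by have /asboolP := bfunP h. Qed.

Lemma bfun_of (h : X -> R) (b : R) : (forall t, `|h t| <= b) ->
  exists g : bfun, forall t, g t = h t.
Proof.
move=> hb; have hP : (h : X -> R^o) \in bfun_pred by apply/asboolP; exists b.
by exists (BFun hP).
Qed.

Lemma bfun_sumE (I : Type) (s : seq I) (F : I -> bfun) t :
  (\sum_(i <- s) F i) t = \sum_(i <- s) F i t.
Proof. by elim: s => [|i s IH]; rewrite ?big_nil// !big_cons -IH. Qed.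

End bounded_functions.

Section means.
Context {R : realType} {X : choiceType}.
Implicit Types (h : bfun R X) (m : bfun R X -> R).

(** Applied to [h] and [- h], the bound gives positivity and total mass 1: these are the finitely
    additive probabilities. *)
Definition mean m := linear (m : bfun R X -> R^o) /\
  forall h (b : R), (forall t, h t <= b) -> m h <= b.

(** Hahn-Banach below the sup functional, with the cone generated by the constraints [(h, k)] for
    [h] in [F]; the hypothesis says that this cone is admissible. The point [x0] makes the supremum
    genuine. *)
Lemma separating_mean (x0 : X) (F : set (bfun R X)) (k : R) :
  (forall L : seq (R * bfun R X), (forall u, u \in L -> 0 <= u.1 /\ F u.2) ->
    forall b : R, (forall t, \sum_(u <- L) u.1 * u.2 t <= b) ->
      k * \sum_(u <- L) u.1 <= b) ->
  exists2 m, mean m & forall h, F h -> k <= m h.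
Proof.
move=> FL; pose p h : R := sup (range h).
have p_ge h t : h t <= p h.
  apply: ub_le_sup; last by exists t.
  by have [b hb] := bfun_bounded h; exists b => _ [s _ <-]; apply: le_trans (hb s); exact: ler_norm.
have p_le h b : (forall t, h t <= b) -> p h <= b.
  by move=> hb; apply: ge_sup; [exists (h x0), x0|move=> _ [t _ <-]].
have sp : sublinear p.
  split.
    by move=> g h; apply: p_le => t; exact: (lerD (p_ge g t) (p_ge h t)).
  by move=> c h c0; apply: p_le => t; exact: (ler_wpM2l (ltW c0) (p_ge h t)).
pose LP (L : seq (R * bfun R X)) := forall u, u \in L -> 0 <= u.1 /\ F u.2.
pose K := [set u : bfun R X * R | exists2 L : seq (R * bfun R X), LP L &
  u = (\sum_(v <- L) v.1 *: v.2, k * \sum_(v <- L) v.1)].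
have aK : admissible_cone p K.
  split.
  - by exists [::] => //; rewrite !big_nil mulr0.
  - move=> _ _ [L LPL ->] [M MP ->]; exists (L ++ M).
      by move=> u; rewrite mem_cat => /orP[/LPL|/MP].
    by rewrite !big_cat mulrDr.
  - move=> c _ c0 [L LPL ->]; exists [seq (c * v.1, v.2) | v <- L].
      move=> _ /mapP[v /LPL[v0 Fv] ->]; split=> //=; by rewrite mulr_ge0// ltW.
    rewrite !big_map /= scaler_sumr -mulr_sumr mulrCA; congr (_, _).
    by apply: eq_bigr => v _; rewrite scalerA.
  - move=> _ [L LPL ->] /=; apply: FL => // t.
    by have := p_ge (\sum_(v <- L) v.1 *: v.2) t; rewrite bfun_sumE.
have [q [sq qp qK]] := sublinear_cone sp aK.
have [m lm mq] := hahn_banach sq.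
have mb h (b : R) : (forall t, h t <= b) -> m h <= b.
  by move=> hb; apply: le_trans (mq _) _; apply: le_trans (qp _) _; exact: p_le.
exists m => // h Fh; rewrite -[m h]opprK lerNr.
have -> : - m h = m (- h).
  have := lm (-1) h 0; rewrite addr0 !scaleN1r => ->.
  have := lm (-1) 0 0; rewrite addr0 scaler0 scaleN1r addNr => ->.
  by rewrite addr0.
apply: le_trans (mq _) _; apply: (qK (h, k)); exists [:: (1, h)].
  by move=> u; rewrite inE => /eqP ->.
by rewrite !big_seq1 scale1r mulr1.
Qed.

(* By [max_cut], signs turn a combination of the [|x i - x j|] into one of the
   [x i] whose coefficients remain large in l1. *)
Lemma l1_basis_mean (x0 : X) (x : nat -> bfun R X) (k : R) :
  (forall (L : seq (R * nat)) (e : nat -> R), (forall i, `|e i| <= 1) ->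
    forall b : R, (forall t, `|\sum_(u <- L) u.1 * x u.2 t| <= b) ->
      k * `|\sum_(u <- L) u.1 * e u.2| <= b) -> 0 <= k ->
  exists2 m, mean m & forall i j h, i != j ->
    (forall t, h t = `|x i t - x j t|) -> k <= m h.
Proof.
move=> xL k0.
pose F := [set h : bfun R X | exists i j, i != j /\ forall t, h t = `|x i t - x j t|].
have [|m mm mF] := separating_mean x0 (F := F) (k := k); last first.
  by exists m => // i j h ij hE; apply: mF; exists i, j.
move=> L LP b Lb.
have /choice[w wP] : forall u : R * bfun R X, exists ij : nat * nat, u \in L ->
    ij.1 != ij.2 /\ forall t, u.2 t = `|x ij.1 t - x ij.2 t|.
  move=> u; have [uL|_] := boolP (u \in L); last by exists (0, 0)%N.
  by have [_ [i [j ?]]] := LP _ uL; exists (i, j).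
have [|e] := @max_cut R [seq (u.1, w u) | u <- L].
  by move=> _ /mapP[u uL ->] /=; split; [have [] := LP _ uL|have [] := wP _ uL].
rewrite !big_map/= => cut.
(* [s u] is 1 or -1 on the pairs that the cut separates and 0 on the others; [M] will list the
   combination of the signed differences. *)
pose s u : R := (e (w u).1)%:R - (e (w u).2)%:R.
have s1 u : `|s u| <= 1.
  by rewrite /s; case: (e _); case: (e _); rewrite ?subrr ?subr0 ?sub0r ?normrN ?normr0 ?normr1.
pose M := flatten [seq [:: (u.1 * s u, (w u).1); (- (u.1 * s u), (w u).2)] | u <- L].
have ME (g : nat -> R) : \sum_(v <- M) v.1 * g v.2 =
    \sum_(u <- L) u.1 * s u * (g (w u).1 - g (w u).2).
  rewrite /M big_flatten big_map; apply: eq_bigr => u _.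
  by rewrite !big_cons big_nil /=; ring.
(* The signs [2 e - 1] pair with [M] to twice the weight of the cut, hence at least to the total
   weight. *)
have := xL M (fun n => 2 * (e n)%:R - 1) _ b; rewrite (ME (fun n => 2 * (e n)%:R - 1)).
have -> : \sum_(u <- L) u.1 * s u * ((2 * (e (w u).1)%:R - 1) - (2 * (e (w u).2)%:R - 1)) =
    2 * \sum_(u <- L) u.1 * (e (w u).1 != e (w u).2)%:R :> R.
  rewrite mulr_sumr; apply: eq_bigr => u _; rewrite /s.
  by case: (e _); case: (e _) => /=; ring.
move=> H; have : k * `|2 * \sum_(u <- L) u.1 * (e (w u).1 != e (w u).2)%:R| <= b.
  apply: H => [i|t].
    by case: (e i); rewrite /= ?mulr1 ?mulr0 ?sub0r ?normrN ?normr1//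
      (_ : 2 - 1 = 1 :> R) ?normr1//; ring.
  rewrite (ME (fun n => x n t)); apply: le_trans (ler_norm_sum _ _ _) _.
  apply: le_trans (Lb t); rewrite big_seq [leRHS]big_seq; apply: ler_sum => u uL.
  have [[u0 _] [_ ->]] := (LP _ uL, wP _ uL).
  by rewrite !normrM (ger0_norm u0) -mulrA ler_wpM2l// ler_piMl.
by apply: le_trans; rewrite ler_wpM2l//; apply: le_trans cut (ler_norm _).
Qed.

End means.

(** * Independent sequences from an ultrafilter *)

Section independence.
Context {R : realType} {X S : Type} (mu : set X -> R) (U : set_system S).
Hypothesis mu0 : mu set0 = 0.
Hypothesis muS : forall A B, A `<=` B -> mu A <= mu B.
Hypothesis muU : forall A B, mu (A `|` B) <= mu A + mu B.
Hypothesis mu_disj : forall A B, A `&` B = set0 -> mu A + mu B <= mu (A `|` B).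
Hypothesis mu1 : mu setT <= 1.
Context {UU : UltraFilter U}.

Let ultraN (P : set S) : ~ U P -> U (~` P).
Proof. by case: (in_ultra_setVsetC P UU). Qed.

Implicit Types (A B : S -> set X) (C D E : set X) (g : R).

Definition small A C g := U [set s | mu (C `&` A s) < g].

Lemma smallU A C D g h : small A C g -> small A D h ->
  small A (C `|` D) (g + h).
Proof.
move=> HC HD; apply: filterS (filterI HC HD) => s [/= c d].
by rewrite setIUl; apply: le_lt_trans (muU _ _) _; exact: ltrD.
Qed.

Lemma smallW A C D g h : D `<=` C -> g <= h -> small A C g -> small A D h.
Proof.
move=> DC gh; apply: filterS => s /= cg.
by apply: le_lt_trans (muS (@setSI _ (A s) _ _ DC)) _; apply: lt_le_trans gh.
Qed.

(* If the indicators of the [A s] and [B s] had weak limits [u] and [v] along [U],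
   this would say that [u * v] vanishes almost everywhere on [C]. *)
Definition split_small A B C :=
  forall g, 0 < g -> exists E, small A (C `&` E) g /\ small B (C `\` E) g.

Lemma split_small_sym A B C : split_small A B C -> split_small B A C.
Proof.
move=> H g /H[E [HA HB]]; exists (~` E); split; first by rewrite -setDE.
by rewrite setDE setCK.
Qed.

Lemma split_smallU A B C D :
  split_small A B C -> split_small A B D -> split_small A B (C `|` D).
Proof.
move=> HC HD g g0; have g20 : 0 < g / 2 by rewrite divr_gt0.
have [E [EA EB]] := HC _ g20; have [F [FA FB]] := HD _ g20.
(* On the overlap the splitting of [C] is kept; that of [D] is used only outside [C]. *)
exists ((C `&` E) `|` (D `&` ~` C `&` F)); rewrite [g]splitr; split.
  apply: smallW (lexx _) (smallU EA FA) => x [_ [[? ?]|[[? ?] ?]]]; first by left.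
  by right.
apply: smallW (lexx _) (smallU EB FB) => x [CD nEF].
have [Cx|nCx] := pselect (C x).
  by left; split=> // Ex; apply: nEF; left.
by case: CD => // Dx; right; split=> // Fx; apply: nEF; right.
Qed.

Lemma split_small0 A B : split_small A B set0.
Proof.
by move=> g g0; exists set0; rewrite set0I set0D; split; apply: filterE => s /=;
  rewrite set0I mu0.
Qed.

(* Otherwise disjoint pieces of [C] of the form [C `&` A s], on which the
   splitting is possible, would exhaust [C]. *)
Lemma split_smallI A B C : ~ split_small A B C ->
  U [set s | ~ split_small A B (C `&` A s)].
Proof.
move=> nC; apply: contrapT => /ultraN US.
have {nC} [g [g0 gC]] : exists g, 0 < g /\
    forall E, small A (C `&` E) g -> ~ small B (C `\` E) g.
  move: nC => /existsNP[g /not_implyP[g0 /forallNP gC]].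
  by exists g; split=> // E EA EB; apply: (gC E).
suff exhaust (r : nat) : exists Y, [/\ Y `<=` C, split_small A B Y &
    r%:R * (g / 2) <= mu Y].
  (* After more than [2 / g] rounds, [Y] would have measure above 1. *)
  have [Y [_ _]] := exhaust (Num.truncn (2 / g)).+1.
  apply/negP; rewrite -ltNge; apply: le_lt_trans (muS (subsetT Y)) _.
  apply: le_lt_trans mu1 _; rewrite -ltr_pdivrMr ?divr_gt0//.
  by rewrite mul1r invf_div; exact: truncnS_gt.
elim: r => [|r [Y [YC sY Yr]]].
  by exists set0; split; [exact: sub0set|exact: split_small0|rewrite mul0r mu0].
(* Otherwise the whole part of [C] outside [Y] could go to the [A] side, and together with the
   splitting of [Y] this would split [C] at level [g]. *)
have nsm : ~ small A (C `\` Y) (g / 2).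
  move=> sm; have [E [EA EB]] := sY (g / 2) ltac:(by rewrite divr_gt0).
  apply: (gC ((C `\` Y) `|` (Y `&` E))).
    rewrite [g]splitr.
    apply: smallW (lexx _) (smallU sm EA) => x [_ [|]]; first by left.
    by right.
  apply: smallW EB; last by lra.
  move=> x [Cx nE]; have Yx : Y x.
    by apply: contrapT => nY; apply: nE; left.
  by split=> // Ex; apply: nE; right.
(* One [s] serves both purposes: [C] meets [A s] in a splittable piece, and this piece adds at least
   [g / 2] to the measure of [Y]. *)
have [s [Ss Ls]] := filter_ex (filterI US (ultraN nsm)).
exists (Y `|` (C `&` A s)); split.
- by move=> x [/YC//|[]].
- apply: split_smallU => //; exact: contrapT.
- have -> : Y `|` (C `&` A s) = Y `|` ((C `\` Y) `&` A s).
    apply/seteqP; split => x [Yx|]; try by left.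
      move=> [Cx Ax]; have [Yx|nY] := pselect (Y x); first by left.
      by right.
    by move=> [[Cx _] Ax]; right.
  apply: le_trans (mu_disj _); last first.
    by apply/seteqP; split => // x [Yx [[]]].
  rewrite -natr1 mulrDl mul1r lerD// leNgt; apply/negP; exact: Ls.
Qed.

Lemma split_smallI2 A B C : ~ split_small A B C ->
  U [set s | ~ split_small A B (C `&` A s) /\ ~ split_small A B (C `&` B s)].
Proof.
move=> nC; apply: filterI; first exact: split_smallI.
have nC' : ~ split_small B A C by move=> /split_small_sym.
by apply: filterS (split_smallI nC') => s nCs /split_small_sym.
Qed.

(** The cells are the [2 ^ size w] Boolean pieces cut out of [C] along [w]; the recursive form lets
    statements about [U]-almost all [s] pass through them by induction. *)
Fixpoint all_cells A B (w : seq S) (Q : set X -> Prop) C : Prop :=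
  if w is s :: w' then all_cells A B w' Q (C `&` A s) /\ all_cells A B w' Q (C `&` B s)
  else Q C.

Lemma all_cells_rcons A B w s Q C : all_cells A B (rcons w s) Q C =
  all_cells A B w (fun D => Q (D `&` A s) /\ Q (D `&` B s)) C.
Proof. by elim: w C => //= t w IH C; rewrite !IH. Qed.

Lemma all_cells_point A B w C (e : nat -> bool) : all_cells A B w nonempty C ->
  exists2 x, C x & forall j s, (nth None (map Some w) j) = Some s ->
    (if e j then A s else B s) x.
Proof.
elim: w C e => [|s w IH] C e /=.
  by move=> [x Cx]; exists x => // j s; rewrite nth_nil.
move=> [HA HB].
have [x Cx xP] : exists2 x, (C `&` (if e 0 then A s else B s)) x &
    forall j t, nth None (map Some w) j = Some t ->
      (if e j.+1 then A t else B t) x.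
  by case: (e 0); exact: (IH _ (fun j => e j.+1)).
case: Cx => Cx sx; exists x => // -[|j] t /=; first by move=> [<-].
exact: xP.
Qed.

(** Points are picked greedily so that no cell becomes splittable: each of the finitely many cells
    survives both cuts for [U]-almost all [s], so one [s] serves them all. Such cells are nonempty
    because the empty set splits. *)
Lemma independent_sequence A B : ~ split_small A B setT ->
  exists s : nat -> S, forall (n : nat) (e : nat -> bool),
    exists x, forall j, (j < n)%N -> (if e j then A (s j) else B (s j)) x.
Proof.
move=> nT; pose good w := all_cells A B w (fun C => ~ split_small A B C) setT.
have /choice[g gP] w : exists s, good w -> good (rcons w s).
  have [gw|ngw] := pselect (good w); last first.
    by have [s _] := filter_ex (@filterT _ U _); exists s.
  suff /filter_ex[s ws] : U [set s | good (rcons w s)] by exists s.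
  rewrite /good; under eq_set do rewrite all_cells_rcons.
  move: gw; rewrite /good; elim: w setT {nT good} => [|t w IH] C /=.
    exact: split_smallI2.
  by move=> [/IH HA /IH HB]; exact: filterI.
pose w := fix w n := if n is n'.+1 then rcons (w n') (g (w n')) else [::].
have wE n : w n = mkseq (fun j => g (w j)) n.
  by elim: n => // n IH; rewrite mkseqS -IH.
exists (fun j => g (w j)) => n e.
have gw : good (w n) by elim: n => //= n; exact: gP.
have ne : all_cells A B (w n) nonempty setT.
  move: gw; rewrite /good; elim: (w n) setT => [|s v IH] C /=; last first.
    by move=> [/IH ? /IH ?].
  move=> nC; apply/set0P/eqP => C0; apply: nC; rewrite C0; exact: split_small0.
have [x _ xP] := all_cells_point e ne; exists x => j jn; apply: xP.
by rewrite wE (nth_map (g [::])) ?size_mkseq// nth_mkseq.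
Qed.

End independence.

(** * From L1-separation to independence *)

Section mean_measure.
Context {R : realType} {X : choiceType}.
Variable m : bfun R X -> R.
Hypothesis mm : mean m.
Implicit Types g h : X -> R.

Definition is_bounded h := exists b : R, forall t, `|h t| <= b.

(* Junk value [m 0] on unbounded functions. *)
Definition meanf h : R := m (insubd (0 : bfun R X) (h : X -> R^o)).

Lemma meanfE (h : bfun R X) : meanf h = m h.
Proof. by rewrite /meanf valKd. Qed.

Lemma is_bounded_bfun h : is_bounded h -> exists k : bfun R X, h = k.
Proof. by move=> [b /bfun_of[k kE]]; exists k; apply/funext => t. Qed.

Lemma meanfD g h : is_bounded g -> is_bounded h ->
  meanf (fun t => g t + h t) = meanf g + meanf h.
Proof.
move=> /is_bounded_bfun[g' ->] /is_bounded_bfun[h' ->].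
rewrite -[fun t => _]/((g' + h' : bfun R X) : X -> R) !meanfE.
by have := mm.1 1 g' h'; rewrite !scale1r.
Qed.

Lemma meanfZ (c : R) h : is_bounded h -> meanf (fun t => c * h t) = c * meanf h.
Proof.
move=> /is_bounded_bfun[h' ->].
rewrite -[fun t => _]/((c *: h' : bfun R X) : X -> R) !meanfE.
have m0 : m 0 = 0.
  have := mm.1 (-1) 0 0; rewrite scaler0 addr0 scaleN1r.
  by rewrite addNr.
by have := mm.1 c h' 0; rewrite m0 !addr0.
Qed.

Lemma meanf_le_cst h (b : R) : is_bounded h -> (forall t, h t <= b) -> meanf h <= b.
Proof. by move=> /is_bounded_bfun[h' ->] hb; rewrite meanfE; exact: mm.2. Qed.

Lemma is_boundedD g h : is_bounded g -> is_bounded h -> is_bounded (fun t => g t + h t).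
Proof.
by move=> [a ga] [b hb]; exists (a + b) => t; rewrite (le_trans (ler_normD _ _))// lerD.
Qed.

Lemma is_boundedZ (c : R) h : is_bounded h -> is_bounded (fun t => c * h t).
Proof.
by move=> [b hb]; exists (`|c| * b) => t; rewrite normrM ler_wpM2l.
Qed.

Lemma is_bounded_sum (I : Type) (s : seq I) (F : I -> X -> R) :
  (forall i, is_bounded (F i)) -> is_bounded (fun t => \sum_(i <- s) F i t).
Proof.
move=> bF; elim: s => [|i s IH].
  by exists 0 => t; rewrite big_nil normr0.
by under eq_fun do rewrite big_cons; exact: is_boundedD.
Qed.

Lemma is_bounded_norm h : is_bounded h -> is_bounded (fun t => `|h t|).
Proof. by move=> [b hb]; exists b => t; rewrite normr_id. Qed.

Lemma is_bounded_cst (c : R) : is_bounded (fun=> c).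
Proof. by exists `|c|. Qed.

Lemma is_bounded_indic (A : set X) : is_bounded (\1_A).
Proof.
by exists 1 => t; rewrite indicE; case: (t \in A); rewrite ?normr1 ?normr0.
Qed.

Lemma meanf0 : meanf (fun=> 0) = 0.
Proof.
rewrite -[RHS](mul0r (meanf (fun=> 0))) -meanfZ; last exact: is_bounded_cst.
by congr meanf; apply/funext => t; rewrite mul0r.
Qed.

Lemma meanf_sum (I : Type) (s : seq I) (F : I -> X -> R) :
  (forall i, is_bounded (F i)) ->
  meanf (fun t => \sum_(i <- s) F i t) = \sum_(i <- s) meanf (F i).
Proof.
move=> bF; elim: s => [|i s IH].
  by rewrite big_nil; under eq_fun do rewrite big_nil; exact: meanf0.
rewrite big_cons -IH -meanfD//; last exact: is_bounded_sum.
by congr meanf; apply/funext => t; rewrite big_cons.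
Qed.

Lemma meanf_le g h : is_bounded g -> is_bounded h -> (forall t, g t <= h t) ->
  meanf g <= meanf h.
Proof.
move=> bg bh gh; rewrite -subr_le0 -mulN1r -meanfZ// -meanfD//; last exact: is_boundedZ.
apply: meanf_le_cst => [|t]; first by apply: is_boundedD => //; exact: is_boundedZ.
by rewrite mulN1r subr_le0.
Qed.

Definition measure_of (A : set X) : R := meanf \1_A.

Lemma measure_of_le g A : is_bounded g -> (forall t, \1_A t <= g t) ->
  measure_of A <= meanf g.
Proof. by move=> bg; apply: meanf_le => //; exact: is_bounded_indic. Qed.

Lemma measure_of0 : measure_of set0 = 0.
Proof.
by rewrite -meanf0; congr meanf; apply/funext => t; rewrite indicE in_set0.
Qed.

Lemma measure_ofS A B : A `<=` B -> measure_of A <= measure_of B.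
Proof.
move=> AB; apply: measure_of_le => [|t]; first exact: is_bounded_indic.
rewrite !indicE ler_nat; have [/set_mem/AB/mem_set -> //|//] := boolP (t \in A).
Qed.

Lemma measure_ofU A B : measure_of (A `|` B) <= measure_of A + measure_of B.
Proof.
rewrite -meanfD; try exact: is_bounded_indic.
apply: measure_of_le => [|t]; first by apply: is_boundedD; exact: is_bounded_indic.
by rewrite !indicE -natrD ler_nat in_setU; case: (_ \in _); case: (_ \in _).
Qed.

Lemma measure_of_disj A B : A `&` B = set0 ->
  measure_of A + measure_of B <= measure_of (A `|` B).
Proof.
move=> AB; rewrite -meanfD; try exact: is_bounded_indic.
apply: meanf_le => [||t]; [by apply: is_boundedD; exact: is_bounded_indic|exact: is_bounded_indic|].
rewrite !indicE -natrD ler_nat in_setU.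
have : t \notin A `&` B by rewrite AB in_set0.
by rewrite in_setI; case: (_ \in _); case: (_ \in _).
Qed.

Lemma measure_of1 : measure_of setT <= 1.
Proof.
apply: meanf_le_cst => [|t]; first exact: is_bounded_indic.
by rewrite indicE in_setT.
Qed.

End mean_measure.

Section separated_independent.
Context {R : realType} {X : choiceType} {S : Type}.
Variables (m : bfun R X -> R) (U : set_system S) (f : S -> X -> R) (M : R).
Hypothesis mm : mean m.
Hypothesis fM : forall s t, `|f s t| <= M.
Context {UU : UltraFilter U}.

Let below a s := [set t | f s t < a].
Let above b s := [set t | b < f s t].
Notation split_at a b := (split_small (measure_of m) U (below a) (above b) setT).

Lemma independent_of_not_split (a b : R) : a < b -> ~ split_at a b ->
  exists s : nat -> S, independent (fun n => f (s n)).
Proof.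
move=> ab /(independent_sequence (measure_of0 mm) (measure_ofS mm)
  (measure_ofU mm) (measure_of_disj mm) (measure_of1 mm))[s sP].
exists s, a, b; split=> // P Q fP fQ PQ0.
have [n nP] : exists n, forall j, P j \/ Q j -> (j < n)%N.
  have /finite_fsetP[F FE] : finite_set (P `|` Q) by rewrite finite_setU.
  exists (\max_(j <- F) j).+1 => j PQj; have /= jF : [set` F] j by rewrite -FE.
  by rewrite ltnS (@leq_bigmax_seq _ (enum_fset F) xpredT id).
(* Indices in [P] go below [a] and all others above [b]; by disjointness those of [Q] are among the
   others. *)
have [x xP] := sP n (fun j => `[< P j >]); exists x; split => j Pj.
  by have := xP j (nP _ (or_introl Pj)); rewrite asboolT.
have := xP j (nP _ (or_intror Pj)); rewrite asboolF// => Pj'.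
by have : (P `&` Q) j by []; rewrite PQ0.
Qed.

(** The levels form a grid of mesh [d] starting at [- M]. A gap longer than [2 * d] contains two
    consecutive levels, the first being the next one after [u]. *)
Lemma level_between (d u v : R) : 0 < d -> `|u| <= M -> `|v| <= M ->
  2 * d < v - u -> exists2 i : 'I_(Num.truncn (2 * M / d)).+2,
    u < - M + d * i%:R & - M + d * i%:R + d < v.
Proof.
move=> d0; rewrite !ler_norml => /andP[u1 u2] /andP[v1 v2] uv.
pose x := (u + M) / d.
have x0 : 0 <= x by rewrite divr_ge0; lra.
have xd : x * d = u + M by rewrite divfK// gt_eqF.
have /andP[t1 t2] := truncn_itv x0.
have iN : ((Num.truncn x).+1 < (Num.truncn (2 * M / d)).+2)%N.
  rewrite ltnS ltnS; apply: le_truncn.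
  by rewrite ler_pM2r ?invr_gt0//; lra.
exists (Ordinal iN) => /=.
  by move: t2; rewrite -(ltr_pM2r d0) xd mulrC; lra.
move: t1; rewrite -(ler_pM2r d0) xd -natr1 mulrDr mulr1 mulrC; lra.
Qed.

(** Without an independent sequence, each pair of levels is split by a set [E i], so for [U]-almost
    all [s] and [t] the functions [f s] and [f t] lie on opposite sides of it only on a set of small
    measure. They are then closer than [eta] in L1(m), against the separation. *)
Lemma separated_independent (eta : R) : 0 < eta ->
  (forall s, U [set s' | eta <= meanf m (fun t => `|f s t - f s' t|)]) ->
  exists s : nat -> S, independent (fun n => f (s n)).
Proof.
move=> eta0 Usep; apply: contrapT => nind.
pose d := eta / 4; have d0 : 0 < d by rewrite divr_gt0.
pose r := (Num.truncn (2 * M / d)).+2.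
pose a (i : 'I_r) := - M + d * i%:R; pose b i := a i + d.
have sp i : split_at (a i) (b i).
  apply: contrapT => /independent_of_not_split H; apply: nind; apply: H.
  by rewrite ltrDl.
have [s0 _] := filter_ex (@filterT _ U _).
have [t0|noX] := pselect (exists t : X, True); last first.
  have [s /= ] := filter_ex (Usep s0); apply/negP; rewrite -ltNge.
  apply: le_lt_trans eta0; apply: meanf_le_cst => // [|t]; last by exfalso; apply: noX; exists t.
  by exists 0 => t; exfalso; apply: noX; exists t.
have M0 : 0 <= M by case: t0 => t _; apply: le_trans (fM s0 t).
(* The crossings will cost at most [2 * M * r * (4 * g)], which this choice keeps below [eta / 2];
   the [+ 1] covers [M = 0]. *)
pose g := eta / (16 * (M + 1) * r%:R).
have r0 : 0 < r%:R :> R by rewrite ltr0n.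
have g0 : 0 < g by rewrite divr_gt0// !mulr_gt0//; lra.
have /choice[E EP] i := sp i g g0.
pose W := [set s | forall i, measure_of m (E i `&` below (a i) s) < g /\
   measure_of m (~` E i `&` above (b i) s) < g].
have UW : U W.
  by rewrite /W -[X in U X]/[set s | _]; apply: filter_forall => i;
    have [HA HB] := EP i; apply: filterI; [move: HA|move: HB];
    rewrite /small ?setTI ?setTD.
have [s Ws] := filter_ex UW.
have [t [Wt /=]] := filter_ex (filterI UW (Usep s)).
apply/negP; rewrite -ltNge.
(* A crossing point lies either in [E i], where [f p] is rarely below [a i], or outside, where [f q]
   is rarely above [b i]. *)
have cross (p q : S) i : W p -> W q ->
    measure_of m (below (a i) p `&` above (b i) q) < 2 * g.
  move=> /(_ i)[Wp _] /(_ i)[_ Wq].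
  apply: (@le_lt_trans _ _ (measure_of m (E i `&` below (a i) p) +
     measure_of m (~` E i `&` above (b i) q))); last by lra.
  apply: le_trans (measure_ofU mm _ _); apply: measure_ofS => // x [xp xq].
  by have [Ex|nEx] := pselect (E i x); [left|right].
pose h p q (i : 'I_r) : X -> R := \1_(below (a i) p `&` above (b i) q).
have bh p q i : is_bounded (h p q i) by exact: is_bounded_indic.
have bf p : is_bounded (f p) by exists M.
(* Pointwise, either the two functions differ by at most [2 * d = eta / 2], or some pair of levels
   is crossed and the trivial bound [2 * M] is charged to its indicator. *)
apply: (@le_lt_trans _ _ (meanf m (fun x => eta / 2 +
    2 * M * (\sum_(i < r) (h s t i x + h t s i x))))).
  apply: meanf_le => //.
  - apply: is_bounded_norm; apply: is_boundedD => //.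
    by under eq_fun do rewrite -mulN1r; exact: is_boundedZ.
  - apply: is_boundedD; first exact: is_bounded_cst.
    by apply: is_boundedZ; apply: is_bounded_sum => i; exact: is_boundedD.
  - move=> x; rewrite -[leLHS]/(`|f s x - f t x|).
    have hge p q i : 0 <= h p q i x by rewrite /h indicE ler0n.
    have tot i : h s t i x + h t s i x <= \sum_(i < r) (h s t i x + h t s i x).
      by rewrite (bigD1 i)//= lerDl sumr_ge0// => j _; exact: addr_ge0.
    have one p q i : f p x < a i -> b i < f q x -> h p q i x = 1.
      by move=> ? ?; rewrite /h indicE mem_set.
    have key p q : 2 * d < f q x - f p x -> exists i, h p q i x = 1.
      move=> /(level_between d0 (fM p x) (fM q x))[i ai bi].
      by exists i; apply: one.
    have dist : `|f s x - f t x| <= 2 * M.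
      apply: le_trans (ler_normB _ _) _; have := fM s x; have := fM t x; lra.
    have sum0 : 0 <= \sum_(i < r) (h s t i x + h t s i x).
      by apply: sumr_ge0 => i _; exact: addr_ge0.
    have big1 : 1 <= \sum_(i < r) (h s t i x + h t s i x) ->
        `|f s x - f t x| <= eta / 2 + 2 * M * \sum_(i < r) (h s t i x + h t s i x).
      move=> H; apply: le_trans dist _; rewrite -[leLHS]addr0 addrC lerD//; first by lra.
      by rewrite ler_peMr//; lra.
    have [st|st] := ltP (2 * d) (f t x - f s x).
      have [i hi] := key _ _ st; apply: big1; have := tot i.
      by rewrite hi; have := hge t s i; lra.
    have [ts|ts] := ltP (2 * d) (f s x - f t x).
      have [i hi] := key _ _ ts; apply: big1; have := tot i.
      by rewrite hi; have := hge s t i; lra.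
    apply: (@le_trans _ _ (eta / 2)).
      by rewrite ler_norml; move: st ts; rewrite /d; lra.
    by rewrite lerDl mulr_ge0//; lra.
have bhh i : is_bounded (fun x => h s t i x + h t s i x) by exact: is_boundedD.
rewrite meanfD//; [|exact: is_bounded_cst|by apply: is_boundedZ; exact: is_bounded_sum].
have bS : is_bounded (fun x => \sum_(i < r) (h s t i x + h t s i x)).
  by apply: is_bounded_sum => i; exact: bhh.
rewrite (meanfZ mm _ bS).
rewrite (meanf_sum mm _ bhh).
apply: (@le_lt_trans _ _ (eta / 2 + 2 * M * \sum_(i < r) (4 * g))).
  apply: lerD.
    by apply: meanf_le_cst => //; exact: is_bounded_cst.
  apply: ler_wpM2l; first by lra.
  apply: ler_sum => i _; rewrite meanfD//.
  by have := cross _ _ i Ws Wt; have := cross _ _ i Wt Ws; rewrite /measure_of /h; lra.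
rewrite sumr_const card_ord -[_ *+ r]mulr_natr.
have gE : g * r%:R * (16 * (M + 1)) = eta.
  by rewrite /g; field; rewrite !gt_eqF//; lra.
have gr0 : 0 < g * r%:R by rewrite mulr_gt0.
have -> : 2 * M * (4 * g * r%:R) = 8 * (M * (g * r%:R)) by ring.
have : M * (g * r%:R) * 16 + g * r%:R * 16 = eta by rewrite -[RHS]gE; ring.
by lra.
Qed.

End separated_independent.

(** Rounding [(b k i + D) / e] down leaves only finitely many vectors, so two indices share one. *)
Lemma bounded_pigeonhole (R : realType) (r : nat) (b : nat -> 'I_r -> R) (D e : R) :
  0 < e -> (forall k i, `|b k i| <= D) ->
  exists k l, k != l /\ forall i, `|b k i - b l i| <= e.
Proof.
move=> e0 bD.
pose N := (Num.truncn (2 * D / e)).+1.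
pose x k i := (b k i + D) / e.
have x0 k i : 0 <= x k i.
  by rewrite divr_ge0 ?(ltW e0)//; have := bD k i; rewrite ler_norml; lra.
have xN k i : (Num.truncn (x k i) < N)%N.
  rewrite ltnS; apply: le_truncn; rewrite ler_pM2r ?invr_gt0//.
  by have := bD k i; rewrite ler_norml; lra.
pose c (k : 'I_(#|{ffun 'I_r -> 'I_N}|.+1)) := [ffun i => Ordinal (xN k i)].
have /injectiveP/injectivePn[k [l kl ckl]] : ~ injective c.
  by move=> /leq_card; rewrite card_ord ltnn.
exists (val k), (val l); split=> // i.
have tkl : Num.truncn (x k i) = Num.truncn (x l i).
  by have := congr1 (fun h : {ffun 'I_r -> 'I_N} => val (h i)) ckl; rewrite !ffunE.
have /andP[k1 k2] := truncn_itv (x0 k i); have /andP[l1 l2] := truncn_itv (x0 l i).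
have bE j : b j i = x j i * e - D by rewrite divfK ?gt_eqF//; ring.
rewrite !bE opprB addrA subrK -mulrBl normrM (gtr0_norm e0) ler_piMl ?(ltW e0)//.
by rewrite ler_norml; move: k1 k2 l1 l2; rewrite tkl -natr1; lra.
Qed.

(** * From an l1-sequence near bounded combinations to independence *)

Section l1_in_hull.
Context {R : realType} {X S : choiceType}.
Variables (f : S -> X -> R) (M : R).
Hypothesis M0 : 0 <= M.
Hypothesis fM : forall s t, `|f s t| <= M.

(** The sets of points [eta]-far from a finite list generate a proper filter because no finite list
    is a net; any finer ultrafilter is separated in L1(m). *)
Lemma not_totally_bounded_independent (m : bfun R X -> R) (eta : R) :
  mean m -> 0 < eta ->
  ~ (exists w : seq S, forall s, exists2 v, v \in w &
      meanf m (fun t => `|f v t - f s t|) < eta) ->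
  exists s : nat -> S, independent (fun n => f (s n)).
Proof.
move=> mm eta0 ntb.
pose far (w : seq S) := [set s | forall v, v \in w -> eta <= meanf m (fun t => `|f v t - f s t|)].
pose F : set_system S := [set P | exists w : seq S, far w `<=` P].
have FF : ProperFilter F.
  split.
    move=> [w w0]; apply: ntb; exists w => s; apply: contrapT => H.
    apply: (w0 s) => v vw; rewrite leNgt; apply/negP => lt.
    by apply: H; exists v.
  split.
  - by exists [::].
  - move=> P Q [v vP] [w wQ]; exists (v ++ w) => s vws; split.
      by apply: vP => u uv; apply: vws; rewrite mem_cat uv.
    by apply: wQ => u uw; apply: vws; rewrite mem_cat uw orbT.
  - by move=> P Q PQ [w wP]; exists w; apply: subset_trans PQ.
have [U [UU FU]] := ultraFilterLemma FF.
apply: (separated_independent (U := U) mm fM eta0) => s.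
by apply: FU; exists [:: s] => s' /(_ s); apply; rewrite inE.
Qed.

(** If the [f s] had a finite net in L1(m), every [x i] would be close to a combination of the net
    points with bounded coefficients, and two of these would come closer than the distance [k] given
    by [l1_basis_mean]. *)
Lemma l1_in_hull_independent (t0 : X) (x : nat -> X -> R) (k : R) : 0 < k ->
  (forall i, is_bounded (x i)) ->
  (forall (L : seq (R * nat)) (e : nat -> R), (forall i, `|e i| <= 1) ->
    forall b : R, (forall t, `|\sum_(u <- L) u.1 * x u.2 t| <= b) ->
      k * `|\sum_(u <- L) u.1 * e u.2| <= b) ->
  (forall z : R, 0 < z -> exists D : R, forall i, exists2 L : seq (R * S),
    \sum_(u <- L) `|u.1| <= D &
    forall t, `|x i t - \sum_(u <- L) u.1 * f u.2 t| <= z) ->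
  exists s : nat -> S, independent (fun n => f (s n)).
Proof.
move=> k0 bx xl1 xhull.
have /choice[y yE] i : exists h : bfun R X, x i = h by exact: is_bounded_bfun.
have {yE} xE : x = fun i => y i : X -> R by apply/funext.
subst x; have [m mm mk] := l1_basis_mean t0 xl1 (ltW k0).
have bdN (h1 h2 : X -> R) : is_bounded h1 -> is_bounded h2 -> is_bounded (fun t => `|h1 t - h2 t|).
  move=> b1 b2; apply: is_bounded_norm; apply: is_boundedD => //.
  by under eq_fun do rewrite -mulN1r; exact: is_boundedZ.
have {mk} mk i j : i != j -> k <= meanf m (fun t => `|y i t - y j t|).
  move=> ij; have [h hE] : exists h : bfun R X, (fun t => `|y i t - y j t|) = h.
    by apply: is_bounded_bfun; exact: bdN.
  rewrite hE meanfE; apply: mk ij _ => t.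
  by rewrite -hE.
(* Error budget in units of [k / 8]: one for approximating each of [y i] and [y j], one for moving
   each to the net, one for the pigeonhole, so five in all. *)
have [D Dx] := xhull (k / 8) ltac:(by rewrite divr_gt0).
have D0 : 0 <= D.
  by have [L + _] := Dx 0%N; apply: le_trans; exact: sumr_ge0.
pose eta := k / (8 * (D + 1)).
have eta0 : 0 < eta by rewrite divr_gt0// mulr_gt0//; lra.
apply: (not_totally_bounded_independent mm eta0) => -[w wP].
have /choice[c cP] s : exists i : 'I_(size w),
    meanf m (fun t => `|f (tnth (in_tuple w) i) t - f s t|) < eta.
  have [v vw vs] := wP s.
  have iw : (index v w < size w)%N by rewrite index_mem.
  by exists (Ordinal iw); rewrite (tnth_nth v) nth_index.
pose g s := f (tnth (in_tuple w) (c s)).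
have /choice[L LP] i : exists L : seq (R * S), \sum_(u <- L) `|u.1| <= D /\
    forall t, `|y i t - \sum_(u <- L) u.1 * f u.2 t| <= k / 8.
  by have [L LD Lx] := Dx i; exists L.
(* The coefficients once each [f s] is replaced by its net point, collected by net point. *)
pose b i j := \sum_(u <- L i | c u.2 == j) u.1.
have gE i t : \sum_(u <- L i) u.1 * g u.2 t =
    \sum_j b i j * f (tnth (in_tuple w) j) t.
  under [RHS]eq_bigr do rewrite /b mulr_suml big_mkcond.
  rewrite exchange_big/=; apply: eq_bigr => u _.
  by rewrite (bigD1 (c u.2))//= eqxx big1 ?addr0// => j; rewrite eq_sym => /negbTE ->.
have bD i j : `|b i j| <= D.
  have [LD _] := LP i; apply: le_trans LD; apply: le_trans (ler_norm_sum _ _ _) _.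
  by rewrite big_mkcond; apply: ler_sum => u _; case: ifP.
pose e := k / (8 * (M + 1) * ((size w)%:R + 1)).
have w0 : 0 <= (size w)%:R :> R by [].
(* Over [size w] net points bounded by [M], coefficient errors of [e] add up to at most [k / 8]. *)
have e0 : 0 < e by rewrite divr_gt0// !mulr_gt0// ltr_wpDl.
have [i [j [ij bij]]] := bounded_pigeonhole e0 bD.
have := mk _ _ ij; apply/negP; rewrite -ltNge.
pose d i t := \sum_(u <- L i) `|u.1| * `|g u.2 t - f u.2 t|.
have bdd (s : S) : is_bounded (f s) by exists M.
have bd1 (u : R * S) : is_bounded (fun t => `|u.1| * `|g u.2 t - f u.2 t|).
  by apply: is_boundedZ; apply: bdN; exact: bdd.
have bd l : is_bounded (d l) by apply: is_bounded_sum => u; exact: bd1.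
have dk l : meanf m (d l) <= k / 8.
  rewrite (meanf_sum mm (L l) bd1).
  apply: (@le_trans _ _ (\sum_(u <- L l) `|u.1| * eta)).
    apply: ler_sum => u _; rewrite meanfZ//; last by apply: bdN; exact: bdd.
    by apply: ler_wpM2l => //; exact: (ltW (cP u.2)).
  rewrite -mulr_suml; apply: (@le_trans _ _ (D * eta)).
    by rewrite ler_pM2r//; have [] := LP l.
  rewrite /eta mulrA ler_pdivrMr ?mulr_gt0//; last by lra.
  rewrite (_ : k / 8 * (8 * (D + 1)) = k * D + k); last by field.
  by rewrite mulrC; lra.
apply: (@le_lt_trans _ _ (meanf m (fun t => k / 8 * 3 + (d i t + d j t)))).
  apply: meanf_le => //.
  - exact: bdN.
  - exact: (is_boundedD (is_bounded_cst _) (is_boundedD (bd i) (bd j))).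
  move=> t.
  have xg l : `|y l t - \sum_(u <- L l) u.1 * g u.2 t| <= k / 8 + d l t.
    have [_ /(_ t) Lx] := LP l.
    rewrite -(subrKA (\sum_(u <- L l) u.1 * f u.2 t)).
    apply: le_trans (ler_normD _ _) _; apply: lerD => //.
    rewrite -sumrB; apply: le_trans (ler_norm_sum _ _ _) _.
    apply: ler_sum => u _; rewrite -mulrBr normrM distrC//.
  have gg : `|\sum_(u <- L i) u.1 * g u.2 t - \sum_(u <- L j) u.1 * g u.2 t| <= k / 8.
    rewrite !gE -sumrB; apply: le_trans (ler_norm_sum _ _ _) _.
    apply: (@le_trans _ _ (\sum_(l < size w) e * M)).
      by apply: ler_sum => l _; rewrite -mulrBl normrM ler_pM.
    rewrite sumr_const card_ord -[_ *+ size w]mulr_natr.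
    have eE (W : R) : 0 <= W -> k / (8 * (M + 1) * (W + 1)) * M * W =
        (k / 8) * ((M / (M + 1)) * (W / (W + 1))).
      by move=> W0; field; rewrite !gt_eqF//= ltr_wpDl.
    have frac (a : R) : 0 <= a -> 0 <= a / (a + 1) <= 1.
      by move=> a0; rewrite divr_ge0 ?addr_ge0//= ler_pdivrMr; lra.
    have [/andP[m0 m1] /andP[W0 W1]] := (frac _ M0, frac _ w0).
    rewrite /e eE//; apply: ler_piMr; last exact: mulr_ile1.
    by rewrite divr_ge0 ?ltW.
  have := xg i; have := xg j; move: gg; rewrite !ler_norml; lra.
rewrite (meanfD mm); [|exact: is_bounded_cst|exact: is_boundedD].
rewrite (meanfD mm (bd i) (bd j)).
have : meanf m (fun=> k / 8 * 3) <= k / 8 * 3.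
  by apply: (meanf_le_cst mm) => //; exact: is_bounded_cst.
by have := dk i; have := dk j; lra.
Qed.

End l1_in_hull.

(** * The c0-space of a sequence of seminorms *)

Section c0_space.
Variables (R : realType) (Y : completeNormedModType R).

(** Having the norm of [Y] as seminorm 0 makes the sup of the sequence a norm that dominates it. The
    continuity of each single seminorm serves for completeness and for the gliding hump. *)
Record seminorm_seq := SeminormSeq {
  seminorm :> nat -> Y -> R;
  seminorm0 : forall y, seminorm 0 y = `|y|;
  seminormD : forall n y z, seminorm n (y + z) <= seminorm n y + seminorm n z;
  seminormZ : forall n (c : R) y, seminorm n (c *: y) = `|c| * seminorm n y;
  seminorm_bound : forall n, exists C : R, forall y, seminorm n y <= C * `|y| }.

Variable N : seminorm_seq.

Lemma seminormN n y : N n (- y) = N n y.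
Proof. by rewrite -scaleN1r seminormZ normrN1 mul1r. Qed.

Lemma seminorm_zero n : N n 0 = 0.
Proof. by rewrite -(scale0r 0) seminormZ normr0 mul0r. Qed.

Lemma seminorm_ge0 n y : 0 <= N n y.
Proof. by have := seminormD N n y (- y); rewrite subrr seminormN seminorm_zero; lra. Qed.

Lemma seminorm_dist n y z : N n y <= N n z + N n (z - y).
Proof.
by rewrite -[X in _ + X]seminormN opprB addrC -{1}(subrK z y); exact: seminormD.
Qed.

Definition c0_pred : {pred Y} := fun y => `[< forall e : R, 0 < e ->
  exists n0, forall n, (n0 <= n)%N -> N n y <= e >].

Record c0 := C0 { c0_val :> Y; c0P : c0_val \in c0_pred }.

HB.instance Definition _ := [isSub for c0_val].
HB.instance Definition _ := [Choice of c0 by <:].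

Lemma c0_submod_closed : submod_closed c0_pred.
Proof.
split.
  by apply/asboolP => e e0; exists 0%N => n _; rewrite seminorm_zero ltW.
move=> c y z /asboolP yP /asboolP zP; apply/asboolP => e e0.
have c0 : 0 < `|c| + 1 by rewrite ltr_wpDl.
have [i iP] := yP (e / 2 / (`|c| + 1)) ltac:(by rewrite !divr_gt0).
have [j jP] := zP (e / 2) ltac:(by rewrite divr_gt0).
exists (maxn i j) => n; rewrite geq_max => /andP[/iP yn /jP zn].
apply: le_trans (seminormD _ _ _ _) _; rewrite [e]splitr lerD// seminormZ.
move: yn; rewrite ler_pdivlMr// => yn; apply: le_trans yn.
by rewrite mulrC ler_wpM2l ?seminorm_ge0// lerDl.
Qed.

HB.instance Definition _ :=
  GRing.isSubmodClosed.Build _ _ c0_pred (GRing.submod_closed_semi c0_submod_closed).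
HB.instance Definition _ := [SubChoice_isSubLmodule of c0 by <:].

Lemma c0_small (y : c0) (e : R) : 0 < e ->
  exists n0, forall n, (n0 <= n)%N -> N n y <= e.
Proof. by have /asboolP := c0P y; apply. Qed.

Definition c0_norm (y : c0) : R := sup (range (fun n => N n y)).

Lemma c0_has_ubound (y : c0) : has_ubound (range (fun n => N n y)).
Proof.
have [n0 n0P] := c0_small y ltr01.
exists (1 + \sum_(i < n0) N i y) => _ [n _ <-].
have s0 : 0 <= \sum_(i < n0) N i y by apply: sumr_ge0 => i _; exact: seminorm_ge0.
have [/n0P|nn0] := leqP n0 n; first by lra.
have : N n y <= \sum_(i < n0) N i y.
  by rewrite (bigD1 (Ordinal nn0))//= lerDl sumr_ge0// => i _; exact: seminorm_ge0.
by lra.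
Qed.

Lemma seminorm_le (y : c0) n : N n y <= c0_norm y.
Proof. by apply: ub_le_sup (c0_has_ubound y) _ _; exists n. Qed.

Lemma c0_norm_le (y : c0) (b : R) : (forall n, N n y <= b) -> c0_norm y <= b.
Proof.
by move=> yb; apply: ge_sup => [|_ [n _ <-]//]; exists (N 0 y), 0%N.
Qed.

Lemma c0_ler_normD (y z : c0) : c0_norm (y + z) <= c0_norm y + c0_norm z.
Proof.
apply: c0_norm_le => n; rewrite -[leLHS]/(N n (c0_val y + c0_val z)).
apply: le_trans (seminormD N n _ _) _.
by rewrite lerD ?seminorm_le.
Qed.

Lemma c0_normrZ (c : R) (y : c0) : c0_norm (c *: y) = `|c| * c0_norm y.
Proof.
have le k (z : c0) : c0_norm (k *: z) <= `|k| * c0_norm z.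
  apply: c0_norm_le => n; rewrite -[leLHS]/(N n (k *: c0_val z)) seminormZ.
  by rewrite ler_wpM2l ?seminorm_le.
apply/eqP; rewrite eq_le le/=; have [->|c0] := eqVneq c 0.
  rewrite normr0 mul0r; apply: le_trans (seminorm_le _ 0%N); exact: seminorm_ge0.
have := le c^-1 (c *: y); rewrite scalerA mulVf// scale1r.
by rewrite normfV ler_pdivlMl// normr_gt0.
Qed.

Lemma c0_normr0_eq0 (y : c0) : c0_norm y = 0 -> y = 0.
Proof.
move=> y0; apply: val_inj; apply/eqP; rewrite -normr_le0 -(seminorm0 N) -y0.
exact: seminorm_le.
Qed.

HB.instance Definition _ :=
  Lmodule_isNormed.Build R c0 c0_ler_normD c0_normrZ c0_normr0_eq0.

Lemma c0_norm_val (y : c0) : `|c0_val y| <= `|y|.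
Proof. by rewrite -(seminorm0 N); exact: seminorm_le. Qed.

(** The limit exists in [Y]. Each seminorm is continuous there, so the Cauchy bounds pass to the
    limit uniformly in [n]; this gives both membership in [c0] and convergence in its norm. *)
Lemma c0_complete (F : set_system c0) : ProperFilter F -> cauchy F -> cvg F.
Proof.
move=> FF cF.
have cY : cauchy (c0_val @ F).
  apply/cauchyP => e e0; have e20 : 0 < e / 2 by rewrite divr_gt0.
  have [A FA Ad] := cauchy_small cF e20.
  have [u Au] := filter_ex FA; exists (u : Y).
  change (F [set v : c0 | ball (c0_val u) e (c0_val v)]); apply: filterS FA => v Av.
  rewrite /= -ball_normE /ball_/= -[X in X < _]/(`|c0_val (u - v)|).
  apply: le_lt_trans (c0_norm_val _) _.
  by apply: le_lt_trans (Ad _ _ Au Av) _; lra.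
have /cvg_ex[y yF] : cvg (c0_val @ F) by exact: cauchy_cvg.
have lim A (e : R) : F A -> (forall u v, A u -> A v -> `|u - v| <= e) ->
    forall u, A u -> forall n, N n (c0_val u - y) <= e.
  move=> FA Ad u Au n; apply/ler_addgt0Pl => d d0.
  have [C CP] := seminorm_bound N n.
  have C0 : 0 < `|C| + 1 by rewrite ltr_wpDl.
  have dC : 0 < d / (`|C| + 1) by rewrite divr_gt0.
  move/cvgrPdistC_lt : yF => /(_ _ dC) yF.
  have [v [Av vy]] := filter_ex (filterI FA yF).
  rewrite -(subrKA (c0_val v)); apply: le_trans (seminormD _ _ _ _) _.
  rewrite addrC lerD//; last first.
    by apply: le_trans (Ad _ _ Au Av); exact: (seminorm_le (u - v)).
  apply: le_trans (CP _) _; apply: (@le_trans _ _ ((`|C| + 1) * `|c0_val v - y|)).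
    by rewrite ler_wpM2r// (le_trans (ler_norm _))// lerDl.
  by rewrite mulrC -ler_pdivlMr// ltW.
have yP : y \in c0_pred.
  apply/asboolP => e e0; have e20 : 0 < e / 2 by rewrite divr_gt0.
  have [A FA Ad] := cauchy_small cF e20; have [u Au] := filter_ex FA.
  have [n0 n0P] := c0_small u e20; exists n0 => n /n0P un.
  have := seminorm_dist n y (c0_val u); have := lim _ _ FA Ad u Au n; lra.
apply/cvg_ex; exists (C0 yP).
apply/cvgrPdistC_le => e e0; have [A FA Ad] := cauchy_small cF e0.
apply: filterS (FA) => u Au; rewrite -[leLHS]/(c0_norm (u - C0 yP)).
apply: c0_norm_le => n; rewrite -[leLHS]/(N n (c0_val u - y)); exact: (lim A e FA Ad u Au n).
Qed.

HB.instance Definition _ := Uniform_isComplete.Build c0 c0_complete.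

Lemma c0_val_linear : linear (c0_val : c0 -> Y).
Proof. by []. Qed.

HB.instance Definition _ := GRing.isLinear.Build R c0 Y *:%R c0_val c0_val_linear.

Lemma c0_val_continuous : continuous (c0_val : c0 -> Y).
Proof.
apply: (@linear_bound_continuous R c0 Y c0_val 1) => y.
by rewrite mul1r; exact: c0_norm_val.
Qed.

End c0_space.

(** * Isomorphic copies and lower bounds *)

Section copies_of_l1.
Context {R : realType} {V W : normedModType R}.

(** The lower bound makes [T] injective with a [k^-1]-Lipschitz inverse on its range; off the range
    the value of [S] is arbitrary. *)
Lemma contains_copy_of_bound (T : {linear V -> W}) (k : R) : continuous T ->
  0 < k -> (forall x, k * `|x| <= `|T x|) -> contains_copy V W.
Proof.
move=> cT k0 Tk.
have Tinj : injective T.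
  move=> x y xy; apply/eqP; rewrite -subr_eq0 -normr_le0.
  have := Tk (x - y); rewrite linearB xy subrr normr0; rewrite pmulr_rle0//.
have /choice[S SP] w : exists v, forall x, T x = w -> v = x.
  have [[x xw]|nx] := pselect (exists x, T x = w).
    by exists x => y; rewrite -xw => /Tinj.
  by exists 0 => x xw; exfalso; apply: nx; exists x.
have TS x : S (T x) = x by exact: SP.
exists T, S; split=> //.
move=> w U /nbhs_ballP[e /= e0 eU].
change (nbhs (w : subspace (range T)) (S @^-1` U)).
(* Points off the range are isolated in the subspace topology. *)
case: (nbhs_subspaceP (range T) w) => [[x _ xw]|_]; last first.
  by move=> _ ->; apply: eU; exact: ballxx.
apply/nbhs_ballP; exists (k * e) => /= [|z wz [y _ yz]]; first exact: mulr_gt0.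
apply: eU; move: wz; rewrite -xw -yz !TS -!ball_normE /ball_/= -linearB => wz.
by rewrite -(ltr_pM2l k0) /from_subspace TS; exact: le_lt_trans (Tk (x - y)) wz.
Qed.

(** Continuity of the inverse at 0 yields [d] such that [|T x| < d] forces [|x| < 1]; by homogeneity
    [d / 2] is a lower bound. *)
Lemma copy_bound : contains_copy V W -> exists2 T : {linear V -> W},
  continuous T & exists2 k : R, 0 < k & forall x, k * `|x| <= `|T x|.
Proof.
move=> [T [S [cT TS cS]]]; exists T => //.
have S0 : S 0 = 0 by rewrite -(TS 0) linear0.
have : nbhs (0 : subspace (range T)) (S @^-1` (ball (0 : V) 1)).
  by apply: (cS 0); rewrite /from_subspace S0; exact: nbhsx_ballx.
case: (nbhs_subspaceP (range T) 0) => [_|]; last by case; exists 0; rewrite ?linear0.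
move=> /nbhs_ballP[d /= d0 dS].
have {dS} TB x : `|T x| < d -> `|x| < 1.
  move=> Txd; have := dS (T x); rewrite -!ball_normE /ball_/= TS !sub0r !normrN.
  by apply => //; exists x.
exists (d / 2) => [|x]; first by rewrite divr_gt0.
have [->|x0] := eqVneq x 0; first by rewrite normr0 mulr0.
have nx : 0 < `|x| by rewrite normr_gt0.
rewrite leNgt; apply/negP => H.
have dx := mulr_gt0 d0 nx.
have := TB (`|x|^-1 *: x); rewrite linearZ !normrZ normfV normr_id mulVf ?gt_eqF//.
rewrite ltxx => TB1; suff : false by [].
by apply: TB1; rewrite mulrC ltr_pdivrMr//; lra.
Qed.

End copies_of_l1.

(** * Interpolation and the gliding hump *)

Section interpolation.
Variables (R : realType) (X Y : completeNormedModType R) (T : {linear X -> Y}).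
Implicit Types (w : R) (x : X) (y z : Y).

(** A rescaled Peetre K-functional. Up to a factor 2 it is the gauge of [w T(B_X) + w^-1 B_Y], with
    [B_X] and [B_Y] the unit balls. *)
Definition Kfun w y : R := inf_over [set: X] (fun x => w^-1 * `|x| + w * `|y - T x|).

Lemma Kfun_le w y x : 0 < w -> Kfun w y <= w^-1 * `|x| + w * `|y - T x|.
Proof.
move=> w0; apply: (inf_over_le (b := 0)) => // s _.
by rewrite addr_ge0// mulr_ge0// ?invr_ge0 ltW.
Qed.

Lemma le_Kfun w y (b : R) :
  (forall x, b <= w^-1 * `|x| + w * `|y - T x|) -> b <= Kfun w y.
Proof. by move=> H; apply: le_inf_over => //; exists 0. Qed.

Lemma KfunD w y z : 0 < w -> Kfun w (y + z) <= Kfun w y + Kfun w z.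
Proof.
move=> w0; rewrite -lerBlDr; apply: le_Kfun => x.
rewrite lerBlDr -lerBlDl; apply: le_Kfun => x'; rewrite lerBlDl.
apply: le_trans (Kfun_le _ (x + x') w0) _.
rewrite addrACA -!mulrDr lerD// ler_wpM2l ?invr_ge0 ?(ltW w0)// ?ler_normD//.
by rewrite linearD opprD addrACA ler_normD.
Qed.

Lemma KfunZ w (c : R) y : 0 < w -> Kfun w (c *: y) = `|c| * Kfun w y.
Proof.
move=> w0.
have le k z : k != 0 -> Kfun w (k *: z) <= `|k| * Kfun w z.
  move=> k0; rewrite -ler_pdivrMl ?normr_gt0//; apply: le_Kfun => x.
  rewrite ler_pdivrMl ?normr_gt0//; apply: le_trans (Kfun_le _ (k *: x) w0) _.
  by rewrite linearZ -scalerBr !normrZ mulrDr !(mulrCA `|k|).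
have [->|c0] := eqVneq c 0.
  rewrite normr0 mul0r scale0r; apply/eqP; rewrite eq_le; apply/andP; split.
    by have := Kfun_le 0 0 w0; rewrite linear0 subr0 !normr0 !mulr0 addr0.
  by apply: le_Kfun => x; rewrite addr_ge0// mulr_ge0// ?invr_ge0 ltW.
apply/eqP; rewrite eq_le le//=.
have := le c^-1 (c *: y) ltac:(by rewrite invr_eq0).
by rewrite scalerA mulVf// scale1r normfV ler_pdivlMl// normr_gt0.
Qed.

Definition Kseq n y : R := if n is 0%N then `|y| else Kfun (2 ^+ n) y.

Lemma Kseq_pos n : 0 < 2 ^+ n :> R. Proof. exact: exprn_gt0. Qed.

(** Closed transparently, so that its seminorms compute to [Kseq]. *)
Definition Kseminorms : seminorm_seq Y.
Proof.
exists Kseq.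
- by [].
- by case=> [|n] y z; [exact: ler_normD|exact: KfunD (Kseq_pos _)].
- by case=> [|n] c y; [exact: normrZ|exact: KfunZ (Kseq_pos _)].
- move=> n; exists (2 ^+ n) => y; case: n => [|n]; first by rewrite mul1r.
  have := Kfun_le y 0 (Kseq_pos n.+1).
  by rewrite linear0 subr0 normr0 mulr0 add0r.
Defined.

(** Choosing [x] itself in the infimum removes the second term; this decay puts the range of [T]
    inside the c0-space. *)
Lemma Kseq_image n x : Kseq n.+1 (T x) <= (2 ^+ n.+1)^-1 * `|x|.
Proof.
by have := Kfun_le (T x) x (Kseq_pos n.+1); rewrite subrr normr0 mulr0 addr0.
Qed.

Lemma pow2_large (b : R) : exists n, b <= 2 ^+ n.
Proof.
exists (Num.truncn b).+1; apply: ltW; apply: lt_le_trans (truncnS_gt b) _.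
by rewrite -natrX ler_nat ltnW// ltn_expl.
Qed.

Lemma image_c0 x : T x \in c0_pred Kseminorms.
Proof.
apply/asboolP => e e0; have [n0 n0P] := pow2_large (`|x| / e).
exists n0.+1 => -[//|n] nn0; apply: le_trans (Kseq_image _ _) _.
rewrite ler_pdivrMl ?Kseq_pos// -ler_pdivrMr//; apply: le_trans n0P _.
by apply: ler_weXn2l; [rewrite ler1n|exact: ltnW].
Qed.

Definition to_c0 x : c0 Kseminorms := C0 (image_c0 x).

Lemma to_c0_linear : linear to_c0.
Proof. by move=> c x y; apply: val_inj; rewrite /= linearP. Qed.

HB.instance Definition _ :=
  GRing.isLinear.Build R X (c0 Kseminorms) *:%R to_c0 to_c0_linear.

Lemma to_c0_continuous : continuous T -> continuous to_c0.
Proof.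
move=> /continuous_linear_bound[C C0 TC].
apply: (@linear_bound_continuous R X (c0 Kseminorms) to_c0 (C + 1)) => x.
apply: c0_norm_le => -[|n]; first by apply: le_trans (TC x) _; rewrite mulrDl lerDl mul1r.
apply: le_trans (Kseq_image _ _) _; rewrite ler_wpM2r//.
apply: (@le_trans _ _ 1); last by rewrite lerDr.
by rewrite invf_le1 ?Kseq_pos// exprn_ege1// ler1n.
Qed.

(** At a weight of at least [(C + 1) / e], a near-minimiser in [Kfun] has both terms below [C + 1].
    The weight depends on [C] and [e] only, so one [D] serves the whole ball. *)
Lemma c0_decompose (y : c0 Kseminorms) (C e : R) : `|y| <= C -> 0 < e ->
  exists D : R, forall y : c0 Kseminorms, `|y| <= C ->
    exists2 x, `|x| <= D & `|c0_val y - T x| <= e.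
Proof.
move=> yC e0; have C0 : 0 < C + 1 by apply: le_lt_trans (normr_ge0 y) _; lra.
have [n nP] := pow2_large ((C + 1) / e).
have nP' : (C + 1) / e <= 2 ^+ n.+1.
  by apply: le_trans nP _; apply: ler_weXn2l; rewrite ?ler1n.
exists ((C + 1) * 2 ^+ n.+1) => {yC}y yC.
have yK : Kfun (2 ^+ n.+1) (c0_val y) < C + 1.
  apply: (@le_lt_trans _ _ `|y|); last by lra.
  exact: (seminorm_le y n.+1).
have [x xP] : exists x, (2 ^+ n.+1)^-1 * `|x| + 2 ^+ n.+1 * `|c0_val y - T x| < C + 1.
  apply: contrapT => /forallNP H; move: yK; apply/negP; rewrite -leNgt.
  by apply: le_Kfun => x; rewrite leNgt; apply/negP; exact: H.
have p0 := Kseq_pos n.+1.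
have x1 : 0 <= (2 ^+ n.+1)^-1 * `|x| by rewrite mulr_ge0// invr_ge0 ltW.
have x2 : 0 <= 2 ^+ n.+1 * `|c0_val y - T x| by rewrite mulr_ge0// ltW.
exists x; first by rewrite mulrC -ler_pdivrMl//; lra.
apply: (@le_trans _ _ ((C + 1) / 2 ^+ n.+1)).
  by rewrite ler_pdivlMr// mulrC; lra.
by rewrite ler_pdivrMr// mulrC -ler_pdivrMr.
Qed.

End interpolation.

Section gliding_hump.
Context {R : realType} {Y : completeNormedModType R} (N : seminorm_seq Y).
Implicit Types c d : l1 R nat.

Definition supported (a b : nat) c := forall i, ~~ (a <= i < b)%N -> c i = 0.

Lemma norm_disjoint a b b' c d : supported 0 a c -> supported b b' d ->
  (a <= b)%N -> `|c + d| = `|c| + `|d|.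
Proof.
move=> ca db ab; rewrite !l1_normE -[norm1 c]norm1_abs -[norm1 d]norm1_abs.
rewrite -norm1D_ge0//; try by rewrite abs_summable_abs l1_summable.
rewrite -norm1_abs; congr norm1; apply/funext => i.
rewrite -[(c + d) i]/(c i + d i); have [ia|ai] := ltnP i a.
  by rewrite (db i) ?addr0 ?normr0 ?addr0// negb_and -ltnNge (leq_trans ia).
by rewrite (ca i) ?add0r ?normr0 ?add0r//= -leqNgt.
Qed.

(** Otherwise every tail has unit vectors with arbitrarily small image in [Y]. Disjointly supported
    ones are added so that no seminorm sees more than one of them at full size: the l1-norm grows
    like [j], the image norm only like [C + j * e]. *)
Lemma gliding_hump (U : {linear l1 R nat -> c0 N}) (C k : R) :
  (forall c, `|U c| <= C * `|c|) -> 0 <= C -> 0 < k ->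
  (forall c, k * `|c| <= `|U c|) ->
  exists n0, exists2 e : R, 0 < e &
    forall b c, supported n0 b c -> e * `|c| <= `|c0_val (U c)|.
Proof.
move=> UC C0 k0 Uk; apply: contrapT => nH.
have H n0 (e : R) : 0 < e -> exists b c,
    [/\ supported n0 b c, `|c| = 1 & `|c0_val (U c)| <= e].
  move=> e0; apply: contrapT => nHe; apply: nH; exists n0, e => // b c cb.
  have [->|c0] := eqVneq c 0; first by rewrite normr0 mulr0.
  have nc : 0 < `|c| by rewrite normr_gt0.
  rewrite leNgt; apply/negP => lt; apply: nHe.
  exists b, (`|c|^-1 *: c); split.
  - by move=> i /cb ci; rewrite -[LHS]/(`|c|^-1 * c i) ci mulr0.
  - by rewrite normrZ normfV normr_id mulVf// gt_eqF.
  - rewrite !linearZ normrZ normfV normr_id ler_pdivrMl// mulrC; exact: ltW.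
have tower (e : R) (j : nat) : 0 < e -> exists b c,
    [/\ supported 0 b c, `|c| = j%:R & `|U c| <= C + j%:R * e].
  move=> e0; elim: j => [|j [b [c [cb cj Uc]]]].
    by exists 0%N, 0; split=> //; rewrite ?linear0 ?normr0 ?mul0r ?addr0.
  have [n0 n0P] := c0_small (U c) e0.
  have /choice[B BP] n := seminorm_bound N n.
  (* The old sum is small in the seminorms from [n0] on; an image of norm at most [e / Bs] in [Y]
     makes the new vector small in those before [n0]. *)
  pose Bs := 1 + \sum_(i < n0) `|B i|.
  have Bs0 : 0 < Bs by rewrite ltr_pwDl// sumr_ge0.
  have [b' [d [db d1 Ud]]] := H b (e / Bs) ltac:(by rewrite divr_gt0).
  exists (maxn b b'), (c + d); split.
  - move=> i; rewrite /= -leqNgt geq_max => /andP[bi b'i].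
    rewrite -[LHS]/(c i + d i) cb ?db ?addr0//= ?negb_and -?leqNgt ?bi ?b'i ?orbT//.
  - by rewrite (norm_disjoint cb db)// cj d1 natr1.
  have dC : `|U d| <= C by have := UC d; rewrite d1 mulr1.
  have jE : C + j.+1%:R * e = C + j%:R * e + e by rewrite -natr1; ring.
  rewrite jE linearD; apply: c0_norm_le => n.
  rewrite -[leLHS]/(N n (c0_val (U c) + c0_val (U d))).
  apply: le_trans (seminormD _ _ _ _) _.
  have [nn0|nn0] := leqP n0 n.
    apply: (@le_trans _ _ (e + C)).
      by apply: lerD; [exact: n0P|apply: le_trans (seminorm_le _ _) dC].
    have : 0 <= j%:R * e by rewrite mulr_ge0// ltW.
    by lra.
  apply: lerD; first by apply: le_trans (seminorm_le _ _) Uc.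
  apply: le_trans (BP n _) _; apply: (@le_trans _ _ (Bs * (e / Bs))).
    apply: (@le_trans _ _ (Bs * `|c0_val (U d)|)); last by rewrite ler_wpM2l// ltW.
    rewrite ler_wpM2r// (le_trans (ler_norm _))// /Bs (bigD1 (Ordinal nn0))//=.
    rewrite addrCA lerDl addr_ge0// sumr_ge0//.
  by rewrite mulrCA divff ?mulr1// gt_eqF.
(* With [e = k / 2], the lower bound [k * j <= C + j * k / 2] fails for such [j]. *)
have [j jP] : exists j : nat, 2 * C / k < j%:R.
  by exists (Num.truncn (2 * C / k)).+1; exact: truncnS_gt.
have [b [c [_ cj Uc]]] := tower (k / 2) j ltac:(by rewrite divr_gt0).
have := Uk c; rewrite cj; move: jP; rewrite ltr_pdivrMr// leNgt => jP /negP; apply.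
by apply: le_lt_trans Uc _; rewrite [k in ltRHS]splitr mulrDl mulrC; lra.
Qed.

(** The [y i] are the images of the basis vectors from [n0] on. Since [L] may repeat indices, the
    l1-norm of the combination is expressed through its pairings with the bounded sequences [e]. *)
Lemma l1_copy_in_c0 : contains_copy (l1 R nat) (c0 N) ->
  exists (y : nat -> c0 N) (C k : R), [/\ 0 < k, forall i, `|y i| <= C &
    forall (L : seq (R * nat)) (e : nat -> R), (forall i, `|e i| <= 1) ->
      k * `|\sum_(u <- L) u.1 * e u.2| <=
      `|\sum_(u <- L) u.1 *: c0_val (y u.2)|].
Proof.
move=> /copy_bound[U cU [k k0 Uk]].
have [C C0 UC] := continuous_linear_bound cU.
have [n0 [q q0 qP]] := gliding_hump UC C0 k0 Uk.
exists (fun i => U (delta (n0 + i)%N)), C, q; split=> // [i|L e e1].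
  by have := UC (delta (n0 + i)%N); rewrite norm_delta mulr1.
pose c := \sum_(u <- L) u.1 *: delta (n0 + u.2)%N : l1 R nat.
have -> : \sum_(u <- L) u.1 *: c0_val (U (delta (n0 + u.2)%N)) = c0_val (U c).
  rewrite /c !linear_sum; apply: eq_bigr => u _; by rewrite !linearZ.
(* The pairing with [e], shifted by [n0], as a functional of norm at most 1; it is evaluated only at
   indices [n0 + i], where the truncated subtraction is exact. *)
have [g g1 gE] := dual_of_bounded (I := nat) (phi := fun i => e (i - n0)%N) ler01
  ltac:(by move=> i; exact: e1).
have -> : \sum_(u <- L) u.1 * e u.2 = g c.
  rewrite /c linear_sum; apply: eq_bigr => u _.
  rewrite linearZ -[e u.2](congr1 e (addKn n0 u.2)).
  by congr (_ * _); rewrite -(gE (n0 + u.2)%N).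
have cE i : c i = \sum_(u <- L) u.1 * (i == n0 + u.2)%:R.
  rewrite /c; elim: L {c} => [|u L IH]; first by rewrite !big_nil.
  by rewrite !big_cons -IH.
apply: (@le_trans _ _ (q * `|c|)).
  rewrite ler_pM2l//; apply: le_trans (ler_dual_norm g c) _.
  by rewrite ler_piMl.
apply: (qP (n0 + \max_(u <- L) u.2).+1) => i nb; rewrite cE big_seq big1// => u uL.
case: eqP => [iE|_]; last by rewrite mulr0.
move: nb; rewrite iE leq_addr/= ltnS leq_add2l.
by rewrite (@leq_bigmax_seq _ L xpredT (fun u => u.2)).
Qed.

End gliding_hump.

(** * Tame functionals and tame functions *)

Section l1_maps.
Context {R : realType}.

Lemma l1_approx (I : choiceType) (a : l1 R I) (e : R) : 0 < e ->
  exists A : {fset I}, `|a - \sum_(i <- A) a i *: delta i| <= e.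
Proof.
move=> e0; have [A tA] := norm1_tail (l1_summable a) e0; exists A.
set aA := \sum_(i <- A) _.
have aE j : aA j = if j \in A then a j else 0.
  rewrite -[aA j]/((\val aA : I -> R^o) j) raddf_sum fct_sumE.
  rewrite (eq_bigr (fun i => a i * (j == i)%:R))//.
  case: ifPn => jA.
    rewrite (big_fsetD1 j)//= eqxx mulr1 big1_fset ?addr0// => i.
    by rewrite !inE eq_sym => /andP[/negbTE -> _]; rewrite mulr0.
  rewrite big1_seq// => i /andP[_ iA]; case: eqP => [ji|]; last by rewrite mulr0.
  by rewrite ji iA in jA.
apply: le_trans tA; rewrite l1_normE le_eqVlt; apply/orP; left; apply/eqP.
congr norm1; apply/funext => j; rewrite -[LHS]/(a j - aA j) aE.
by case: ifP; rewrite ?subrr ?subr0.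
Qed.

Section pushforward.
Context {I J : choiceType} (s : I -> J).
Implicit Type c : l1 R I.

Let F c (i : I) (j : J) : R := c i * (j == s i)%:R.

Let F_norm i c : abs_summable (F c i) /\ norm1 (F c i) = `|c i|.
Proof.
have sd := @delta_summable R J (s i).
split; first exact: abs_summableZ.
by rewrite norm1Z// -[norm1 _]/(`|delta (s i) : l1 R J|) norm_delta mulr1.
Qed.

Let F_summable c : abs_summable (uncur (F c)) /\ norm1 (uncur (F c)) = `|c|.
Proof.
have E : (fun i => norm1 (F c i)) = fun i => `|(c i : R)|.
  by apply/funext => i; rewrite (F_norm i c).2.
have sF : abs_summable (uncur (F c)).
  apply: pair_summable => [i|]; first exact: (F_norm i c).1.
  by rewrite E abs_summable_abs; exact: l1_summable.
by split=> //; have [_ _ ->] := summable_pair sF; rewrite E norm1_abs.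
Qed.

Let G c (j : J) : R := usum (fun i => F c i j).

Let Fj_summable c j : abs_summable (fun i => F c i j).
Proof.
by have [] := F_summable c; rewrite -summable_swap => /summable_pair[].
Qed.

Let G_summable c : abs_summable (G c).
Proof. by have [] := F_summable c; rewrite -summable_swap => /usum_pair[]. Qed.

(** The contraction of l1-spaces that extends [s] linearly, adding up the masses on each fibre. *)
Definition pushforward c : l1 R J := L1 (G_summable c).

Lemma pushforward_linear : linear pushforward.
Proof.
move=> k c d; apply: val_inj; apply/funext => j.
rewrite -[RHS]/(k * G c j + G d j) /= /G -usumZ// -usumD//; last exact: abs_summableZ.
congr usum; apply/funext => i; rewrite /F -[(k *: c + d) i]/(k * c i + d i).
by rewrite mulrDl mulrA.
Qed.

HB.instance Definition _ :=
  GRing.isLinear.Build R (l1 R I) (l1 R J) *:%R pushforward pushforward_linear.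

Lemma norm_pushforward c : `|pushforward c| <= `|c|.
Proof.
have [sF <-] := F_summable c; rewrite -norm1_swap.
move: sF; rewrite -summable_swap => sF; have [sk snk ->] := summable_pair sF.
apply: norm1_le => // j.
by rewrite [leRHS]ger0_norm ?norm1_ge0//; exact: ler_usum.
Qed.

Lemma pushforward_delta i : pushforward (delta i) = delta (s i).
Proof.
apply: val_inj; apply/funext => j; rewrite /= /G.
rewrite (@usum_fin R I _ [fset i]%fset _).2.
  by rewrite big_seq_fset1 /F deltaE eqxx mul1r.
by move=> k; rewrite inE /F deltaE => /negbTE ->; rewrite mul0r.
Qed.

End pushforward.
End l1_maps.

Lemma dual_sumE (R : realType) (V : normedModType R) (I : Type) (r : seq I)
    (z : I -> dual V) v : (\sum_(i <- r) z i) v = \sum_(i <- r) z i v.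
Proof. by elim: r => [|i r IH]; rewrite ?big_nil// !big_cons -IH. Qed.

Section tame.
Context {R : realType} {G : groupType} (f : dual (l1 R G)).
Local Notation phi := (f \o delta : G -> R).
Local Notation T := (dual_act f).

Lemma dual_act_delta (s t : G) : T (delta s) (delta t) = phi (s * t)%g.
Proof. by rewrite dual_actE bmul_delta. Qed.

Lemma dual_l1_norm_le (y : dual (l1 R G)) (b : R) :
  (forall t, `|y (delta t)| <= b) -> `|y| <= b.
Proof.
move=> yb; rewrite dual_l1_isometry; apply: ge_sup.
  by exists `|y (delta 1%g)|, 1%g.
by move=> _ [t _ <-].
Qed.

(** Independence bounds [T] from below on combinations of the chosen translates. As [T] factors
    through [al], the map [al \o pushforward s] is bounded from below and embeds l1 into [V3]. *)
Lemma tame_function_of_functional : tame_functional f -> tame_function phi.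
Proof.
move=> [V3 [al [be [V3R cal cbe TE]]]].
have phib t : `|phi t| <= `|f| by exact: dual_l1_bounded.
split; first by exists `|f|.
split; first by exists `|f| => _ [s _ <-] t; exact: phib.
move=> [g [gphi [a [b [ab gind]]]]]; apply: V3R.
have /choice[s sg] n : exists s, g n = fun t => phi (s * t)%g.
  by have [s _ <-] := gphi n; exists s.
have [K K0 beK] := continuous_linear_bound cbe.
have [B B0 TB] := continuous_linear_bound (@dual_act_continuous _ _ f).
pose U : {linear l1 R nat -> V3} := al \o pushforward s.
have cJ : continuous (pushforward s : l1 R nat -> l1 R G).
  apply: (@linear_bound_continuous _ _ _ (pushforward s) 1) => c.
  by rewrite mul1r norm_pushforward.
apply: (@contains_copy_of_bound _ _ _ U ((b - a) / (2 * (K + 1)))).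
- by move=> c; apply: continuous_comp; [exact: cJ|exact: cal].
- by rewrite divr_gt0 ?subr_gt0// mulr_gt0// ltr_wpDl.
move=> c; rewrite mulrAC ler_pdivrMr ?mulr_gt0 ?ltr_wpDl//.
suff H : (b - a) * `|c| <= 2 * K * `|U c|.
  by apply: le_trans H _; rewrite [leRHS]mulrC ler_wpM2r//; lra.
apply/ler_addgt0Pr => e e0.
(* The truncation error [d] enters with weight [b - a] through the norm and [2 * B] through the
   values at two points, in total [e]. *)
pose d := e / (2 * B + (b - a)).
have Bab : 0 < 2 * B + (b - a) by lra.
have d0 : 0 < d by rewrite divr_gt0.
have [A Ad] := l1_approx c d0; set cA := \sum_(i <- A) _ in Ad.
have [P [M [fP fM PM PA]]] : exists P M : set nat, [/\ finite_set P, finite_set M,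
    P `&` M = set0 & forall i, i \in A -> (P i /\ c i < 0) \/ (M i /\ 0 <= c i)].
  exists [set i | i \in A /\ c i < 0], [set i | i \in A /\ 0 <= c i]; split.
  - by apply: (finite_subfset A) => i [].
  - by apply: (finite_subfset A) => i [].
  - by apply/seteqP; split => // i [[_ c1] [_]]; rewrite leNgt c1.
  - by move=> i iA; have [c0|c0] := ltP (c i) 0; [left|right].
(* At [x] the translates with negative coefficient are below [a] and the others above [b], at [y]
   the reverse; each term of the difference of values is then at least [b - a] times [|c i|]. *)
have [x [xP xM]] := gind P M fP fM PM.
have [y [yM yP]] := gind M P fM fP ltac:(by rewrite setIC).
have evE t : T (pushforward s cA) (delta t) = \sum_(i <- A) c i * phi (s i * t)%g.
  rewrite /cA !linear_sum dual_sumE; apply: eq_bigr => i _.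
  rewrite !linearZ /= pushforward_delta.
  by rewrite -[LHS]/(c i * T (delta (s i)) (delta t)) dual_act_delta.
have lower : (b - a) * \sum_(i <- A) `|c i| <=
    T (pushforward s cA) (delta x) - T (pushforward s cA) (delta y).
  rewrite !evE -sumrB mulr_sumr big_seq [leRHS]big_seq; apply: ler_sum => i iA.
  rewrite -mulrBr; have [[Pi ci]|[Mi ci]] := PA i iA.
    have := xP i Pi; have := yP i Pi; rewrite /= sg => h1 h2.
    rewrite ltr0_norm// mulrC -[leRHS]mulrNN ler_wpM2l//; lra.
  have := xM i Mi; have := yM i Mi; rewrite /= sg => h1 h2.
  by rewrite ger0_norm// mulrC ler_wpM2l//; lra.
have cA1 : `|cA| <= \sum_(i <- A) `|c i|.
  apply: le_trans (ler_norm_sum _ _ _) _; apply: ler_sum => i _.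
  by rewrite normrZ norm_delta mulr1.
have TcA : `|T (pushforward s cA)| <= K * `|U c| + B * d.
  have -> : T (pushforward s cA) = be (U c) - T (pushforward s (c - cA)).
    rewrite (_ : be (U c) = T (pushforward s c)); last by rewrite TE.
    by apply/eqP; rewrite eq_sym subr_eq -!linearD subrKC.
  apply: le_trans (ler_normB _ _) _; apply: lerD; first exact: beK.
  apply: le_trans (TB _) _; rewrite ler_wpM2l//.
  exact: le_trans (norm_pushforward _ _) Ad.
have ev t : `|T (pushforward s cA) (delta t)| <= K * `|U c| + B * d.
  exact: le_trans (dual_l1_bounded _ _) TcA.
have c_le : `|c| <= d + `|cA| by rewrite -{1}(subrK cA c) (le_trans (ler_normD _ _))// lerD2r.
have dE : d * (2 * B + (b - a)) = e by rewrite divfK// gt_eqF.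
apply: (@le_trans _ _ ((b - a) * (d + \sum_(i <- A) `|c i|))).
  by rewrite ler_wpM2l//; lra.
have := ev x; have := ev y; rewrite !ler_norml => /andP[y1 y2] /andP[x1 x2].
rewrite mulrDr -dE mulrDr; move: lower; lra.
Qed.

Lemma tame_functional_of_function : tame_function phi -> tame_functional f.
Proof.
move=> [_ [_ nind]].
exists (c0 (Kseminorms T)), (to_c0 T), (@c0_val _ _ _); split.
- move=> /l1_copy_in_c0[y [C [k [k0 yC yl1]]]]; apply: nind.
  pose x i t : R := c0_val (y i) (delta t).
  have phib s t : `|phi (s * t)%g| <= `|f| by exact: dual_l1_bounded.
  have [|L e e1 b Lb|z z0|s sind] := @l1_in_hull_independent R G G
    (fun s t => phi (s * t)%g) `|f| (normr_ge0 f) phib 1%g x k k0; last first.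
  + by exists (fun n t => phi (s n * t)%g); split=> // n; exists (s n).
  (* Half of [z] pays for [c0_decompose], half for truncating [a] to finite support. The truncated
     coefficients are still bounded by [D], uniformly in [i]. *)
  + have z20 : 0 < z / 2 by rewrite divr_gt0.
    have [D DP] := c0_decompose (yC 0%N) z20.
    have [B B0 TB] := continuous_linear_bound (@dual_act_continuous _ _ f).
    have B1 : 0 < B + 1 by rewrite ltr_wpDl.
    exists D => i; have [a aD ya] := DP _ (yC i).
    have [A aA] := l1_approx a (divr_gt0 z20 B1); set a' := \sum_(s <- A) _ in aA.
    exists [seq (a s, s) | s <- A].
      rewrite big_map; apply: le_trans aD; exact: norm1_ge (l1_summable a).
    move=> t; rewrite big_map /=.
    have -> : \sum_(s <- A) a s * phi (s * t)%g = T a' (delta t).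
      rewrite /a' linear_sum dual_sumE; apply: eq_bigr => s _.
      by rewrite linearZ -[RHS]/(a s * T (delta s) (delta t)) dual_act_delta.
    rewrite -[x i t - _]/((c0_val (y i) - T a') (delta t)).
    apply: le_trans (dual_l1_bounded _ _) _.
    rewrite -(subrKA (T a)) [z]splitr; apply: le_trans (ler_normD _ _) _.
    apply: lerD => //; rewrite -linearB; apply: le_trans (TB _) _.
    apply: (@le_trans _ _ ((B + 1) * `|a - a'|)); first by rewrite ler_wpM2r// lerDl.
    by rewrite mulrC -ler_pdivlMr.
  (* The dual norm is the supremum over the [delta t], so lower bounds in the dual are lower bounds
     for the sup norm on [G]. *)
  + apply: le_trans (yl1 L e e1) _; apply: dual_l1_norm_le => t.
    by rewrite dual_sumE; exact: Lb.
  + by move=> i; exists `|c0_val (y i)| => t; exact: dual_l1_bounded.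
- exact: to_c0_continuous (@dual_act_continuous _ _ f).
- exact: c0_val_continuous.
- by [].
Qed.
End tame.

Theorem theorem3p2 (R : realType) (G : groupType) (f : dual (l1 R G)) :
  tame_functional f <-> tame_function (f \o delta : G -> R).
Proof.
by split; [exact: tame_function_of_functional|exact: tame_functional_of_function].
Qed.
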